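(* Consider a sequence of data-generating processes indexed by $m=1,2,\dots$ with $K_m\to\infty$ cells and a fixed scalar $\beta$. In cell $a\in\{1,\dots,K_m\}$ and fold $v\in\{0,1\}$ the fold-level means satisfy $\bar S_{a,v,m}=\pi_{a,m}+\bar\eta_{a,v,m}$ and $\bar Y_{a,v,m}=\beta\,\bar S_{a,v,m}+\bar\epsilon_{a,v,m}$, where for each $m$ the pairs $(\bar\eta_{a,v,m},\bar\epsilon_{a,v,m})$, $a\le K_m$, $v\in\{0,1\}$, are i.i.d. with mean zero (the two components of a pair may be correlated), $\sigma^2_{\bar\eta,m}=E\bar\eta_{a,v,m}^2>0$ and $\sigma^2_{\bar\epsilon,m}=E\bar\epsilon_{a,v,m}^2>0$. Let $\widehat\beta_m=\big(\sum_{a=1}^{K_m}\bar S_{a,0,m}\bar S_{a,1,m}\big)^{-1}\sum_{a=1}^{K_m}\bar S_{a,0,m}\bar Y_{a,1,m}$. Assume: (a) $\frac{\sum_{a=1}^{K_m}\pi_{a,m}^2}{K_m\sigma^2_{\bar\eta,m}}\to0$, $\frac{\sigma_{\bar\epsilon,m}}{\sigma_{\bar\eta,m}}\to c\in[0,\infty)$, and $\frac{\sum_{a=1}^{K_m}\pi_{a,m}^2}{\sqrt{K_m}\,\sigma^2_{\bar\eta,m}}\to\infty$; (b) (Lindeberg) for every $\epsilon>0$, $E\Big[\Big(\frac{\bar\eta_{1,0,m}\bar\epsilon_{1,1,m}}{\sigma_{\bar\eta,m}\sigma_{\bar\epsilon,m}}\Big)^2\mathbf 1\Big\{\Big|\frac{\bar\eta_{1,0,m}\bar\epsilon_{1,1,m}}{\sigma_{\bar\eta,m}\sigma_{\bar\epsilon,m}}\Big|\ge\epsilon\sqrt{K_m}\Big\}\Big]\to0$.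 Let $\widehat\sigma_{\bar\eta,m},\widehat\sigma_{\bar\epsilon,m}$ satisfy $\widehat\sigma_{\bar\eta,m}/\sigma_{\bar\eta,m}\to1$ and $\widehat\sigma_{\bar\epsilon,m}/\sigma_{\bar\epsilon,m}\to1$ in probability, let $\alpha\in(0,1)$, $q_{1-\alpha/2}$ the $1-\alpha/2$ quantile of the standard normal distribution, and $\mathcal C_m=\Big[\widehat\beta_m\pm q_{1-\alpha/2}\Big(\frac{\sum_{a=1}^{K_m}\bar S_{a,0,m}\bar S_{a,1,m}}{\sqrt{K_m}}\Big)^{-1}\widehat\sigma_{\bar\eta,m}\widehat\sigma_{\bar\epsilon,m}\Big]$. Then $\Pr_m[\beta\in\mathcal C_m]\to1-\alpha$ and $\widehat\beta_m\to\beta$ in probability.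
   Context: This is the two-fold jackknife instrumental variable estimator in a linear model with one endogenous variable: units in each cell are split into two folds of equal size, $\bar S_{a,v,m}$ and $\bar Y_{a,v,m}$ are the averages of the short-term metric and long-term outcome over the units of cell $a$ in fold $v$, $\pi_{a,m}$ is the (nonrandom) first-stage effect of cell $a$ under the $m$-th process, and $\bar\eta_{a,v,m},\bar\epsilon_{a,v,m}$ are the corresponding fold-level error averages (homoskedastic, i.i.d. across cells and folds since unit-level errors are i.i.d.). *)

(* Defs.v *)
From mathcomp Require Import all_boot all_order all_algebra.
From mathcomp Require Import all_classical all_reals all_analysis.
Set Implicit Arguments. Unset Strict Implicit. Unset Printing Implicit Defensive.
Import Order.TTheory GRing.Theory Num.Theory numFieldNormedType.Exports.
Local Open Scope classical_set_scope.
Local Open Scope ring_scope.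

(* Mutual independence of a finite family of R^2-valued random vectors:
   the product rule for every choice of measurable sets (taking B i = setT
   recovers the product rule for every subfamily). *)
Definition mutually_independent {d} {T : measurableType d} {R : realType}
  (P : probability T R) (I : finType) (X : I -> T -> R * R) : Prop :=
  forall B : I -> set (R * R), (forall i, measurable (B i)) ->
    fine (P (\bigcap_(i in [set: I]) (X i @^-1` B i)))
    = \prod_(i : I) fine (P (X i @^-1` B i)).

Definition identically_distributed {d} {T : measurableType d} {R : realType}
  (P : probability T R) (I : finType) (X : I -> T -> R * R) : Prop :=
  forall (i j : I) (B : set (R * R)), measurable B ->
    P (X i @^-1` B) = P (X j @^-1` B).

Definition cvg_in_prob {d} {T : nat -> measurableType d} {R : realType}
  (P : forall m, probability (T m) R) (X : forall m, T m -> R) (c : R) : Prop :=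
  forall e : R, 0 < e ->
    (fun m => fine (P m [set w | e < `|X m w - c|])) @ \oo --> (0 : R).

(* Fold-level means; fold 0 is [false], fold 1 is [true]; cell a is
   the natural number a < K m (cell "1" of the paper is a = 0). *)
Definition Sbar {d} {T : nat -> measurableType d} {R : realType}
  (pi : nat -> nat -> R) (eta : forall m, nat -> bool -> T m -> R)
  (m a : nat) (v : bool) (w : T m) : R := pi m a + eta m a v w.

Definition Ybar {d} {T : nat -> measurableType d} {R : realType} (beta : R)
  (pi : nat -> nat -> R) (eta eps : forall m, nat -> bool -> T m -> R)
  (m a : nat) (v : bool) (w : T m) : R :=
  beta * Sbar pi eta a v w + eps m a v w.

Definition SS {d} {T : nat -> measurableType d} {R : realType}
  (K : nat -> nat) (pi : nat -> nat -> R) (eta : forall m, nat -> bool -> T m -> R)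
  (m : nat) (w : T m) : R :=
  \sum_(a < K m) Sbar pi eta a false w * Sbar pi eta a true w.

Definition betahat {d} {T : nat -> measurableType d} {R : realType}
  (K : nat -> nat) (beta : R) (pi : nat -> nat -> R)
  (eta eps : forall m, nat -> bool -> T m -> R) (m : nat) (w : T m) : R :=
  (SS K pi eta w)^-1 *
  \sum_(a < K m) Sbar pi eta a false w * Ybar beta pi eta eps a true w.

(* Main.v *)
(** Write [xi_a = eta_{a,0} eps_{a,1} / (sig_eta sig_eps sqrt K)] and
    [W = \sum_a xi_a].  The numerator of [betahat - beta], divided by
    [sig_eta sig_eps sqrt K], is [W] plus a linear term with variance
    [\sum_a pi_a^2 / (K sig_eta^2) -> 0], while its denominator, divided by
    [sqrt K sig_eta^2], is [\sum_a pi_a^2 / (sqrt K sig_eta^2) -> oo] plus a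
    noise that is bounded in L^2.  Hence [betahat] is consistent, and up to events
    of vanishing probability [beta] is covered iff [|W| <= q (1 + o(1))].

    Asymptotic normality of [W] comes from Stein's method: if [f] is C^1 with
    [f'] bounded and uniformly continuous, then a first-order expansion of
    [f (W)] around [f (W - xi_a)], independence of [xi_a] and [W - xi_a], and the
    Lindeberg condition give [E (f' (W) - W f (W)) -> 0].  If a compactly supported
    continuous [g] has Gaussian mean zero, then the solution of [f' - x f = g] is
    [x |-> (\int_{-oo}^x g phi) / phi x], which is compactly supported as well, so
    [E g (W) -> 0]; no bound on the Mills ratio is needed.  Taking for [g] a
    trapezoid minus a multiple of a very wide one, whose mean under [W] is close
    to 1 by Chebyshev's inequality, yields the limit of [P (|W| <= q)]. *)

Require Import Defs.
From HB Require Import structures.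
From mathcomp Require Import all_boot all_order all_algebra.
From mathcomp Require Import all_classical all_reals all_analysis.
From mathcomp Require Import measurable_realfun.
From mathcomp Require Import ring lra.
Set Implicit Arguments. Unset Strict Implicit. Unset Printing Implicit Defensive.
Import Order.TTheory GRing.Theory Num.Theory numFieldNormedType.Exports.
Local Open Scope classical_set_scope.
Local Open Scope ring_scope.

Local Notation L1 P f := (integrable P setT (EFin \o f)).

(** * Independence *)

Definition indep {d d1 d2} {T : measurableType d} {U : measurableType d1}
  {V : measurableType d2} {R : realType} (P : probability T R)
  (f : T -> U) (g : T -> V) : Prop :=
  forall A B, measurable A -> measurable B ->
    (P (f @^-1` A `&` g @^-1` B) = P (f @^-1` A) * P (g @^-1` B))%E.

(** * Independence of generated sigma-algebras *)

Section dynkin_independence.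
Context {d} {T : measurableType d} {R : realType} (P : probability T R).

(** Independence of a fixed [A] passes to complements and disjoint unions but not to intersections,
    so only a Dynkin system results; hence the [setI_closed] generators below. *)
Lemma dynkin_indep (A : set T) : measurable A ->
  dynkin [set B | measurable B /\ (P (A `&` B) = P A * P B)%E].
Proof.
move=> mA; split => /=.
- by rewrite setIT probability_setT mule1.
- move=> B [mB AB]; split; first exact: measurableC.
  rewrite -setDE measureD// ?probability_setC// => [|]; last first.
    by rewrite (le_lt_trans (probability_le1 P mA))// ltry.
  rewrite muleBr ?mule1 ?fin_num_measure//; congr (_ - _)%E; exact: AB.
- move=> F tF mF; split; first by apply: bigcup_measurable => k _; exact: (mF k).1.
  rewrite setI_bigcupr measure_bigcup//; last 2 first.
    by move=> i _; apply: measurableI => //; exact: (mF i).1.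
    apply/trivIsetP => i j _ _ ij; rewrite setIACA setIid.
    by move/trivIsetP : tF => /(_ i j Logic.I Logic.I ij) ->; rewrite setI0.
  rewrite measure_bigcup//; last by move=> i _; exact: (mF i).1.
  rewrite -(@fineK _ (P A)) ?fin_num_measure// -nneseriesZl; last by move=> i _; exact: measure_ge0.
  by apply: eq_eseriesr => i _; rewrite fineK ?fin_num_measure//; exact: (mF i).2.
Qed.

(** Two passes of the Dynkin argument: for a fixed generator in [G], the rule is extended from [H]
    to [<<s H>>]; then, for a fixed set of [<<s H>>], from [G] to [<<s G>>]. *)
Lemma g_sigma_algebra_indep (G H : set (set T)) :
  setI_closed G -> setI_closed H -> G `<=` measurable -> H `<=` measurable ->
  (forall A B, G A -> H B -> P (A `&` B) = P A * P B)%E ->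
  forall A B, <<s G >> A -> <<s H >> B -> (P (A `&` B) = P A * P B)%E.
Proof.
move=> GI HI Gm Hm GH.
have sub (F : set (set T)) A : setI_closed F -> F `<=` measurable -> measurable A ->
    (forall B, F B -> P (A `&` B) = P A * P B)%E ->
    forall B, <<s F >> B -> measurable B /\ (P (A `&` B) = P A * P B)%E.
  move=> FI Fm mA FP B; rewrite -(setI_closed_g_dynkin_g_sigma_algebra FI).
  move: B; apply: smallest_sub; first exact: dynkin_indep.
  by move=> C FC; split; [exact: Fm|exact: FP].
move=> A B GA HB.
(* Here [sub] is applied with [A := setT] just to learn that [B] is measurable. *)
have [mB _] : measurable B /\ (P (setT `&` B) = P setT * P B)%E.
  apply: (sub H) => // C _.
  by rewrite setTI probability_setT mul1e.
rewrite setIC muleC; apply: (sub G _ GI Gm mB _ A GA).2 => C GC.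
rewrite setIC muleC; apply: (sub H C HI Hm (Gm _ GC) _ B HB).2 => D HD.
exact: GH.
Qed.

End dynkin_independence.

(** * Independence of functions of disjoint blocks of variables *)

Section grouping.
Context {d} {T : measurableType d} {R : realType} (P : probability T R).
Context (I : finType) (X : I -> T -> R * R).

(** Generators of the sigma-algebra of the variables indexed by [J]. The intersection runs over all
    of [I], with [setT] outside [J], so that the product rule of [mutually_independent] applies
    directly. *)
Definition cylinders (J : {set I}) : set (set T) :=
  [set A | exists B : I -> set (R * R), [/\ forall i, measurable (B i),
     forall i, i \notin J -> B i = setT &
     A = \bigcap_(i in [set: I]) (X i @^-1` B i)]].

Lemma cylinders_setI J : setI_closed (cylinders J).
Proof.
move=> _ _ [B [mB BT ->]] [C [mC CT ->]]; exists (fun i => B i `&` C i); split.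
- by move=> i; exact: measurableI.
- by move=> i iJ; rewrite BT// CT// setIT.
- by rewrite -bigcapI; apply: eq_bigcapr.
Qed.

Hypothesis mX : forall i, measurable_fun setT (X i).

Lemma cylinders_measurable J : cylinders J `<=` measurable.
Proof.
move=> _ [B [mB BT ->]]; apply: fin_bigcap_measurable => // i _.
by rewrite -[X in measurable X]setTI; exact: mX.
Qed.

Hypothesis XI : mutually_independent P X.

(** On generators, the intersection is again a cylinder, and the product of probabilities splits
    factor by factor because at each index one of the two sets is [setT]. *)
Lemma cylinders_indep (J1 J2 : {set I}) : {in J1, forall i, i \notin J2} ->
  forall A B, <<s cylinders J1 >> A -> <<s cylinders J2 >> B ->
  (P (A `&` B) = P A * P B)%E.
Proof.
move=> J12; apply: g_sigma_algebra_indep; [exact: cylinders_setI|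
  exact: cylinders_setI|exact: cylinders_measurable|exact: cylinders_measurable|].
move=> A B GA GB.
have mA := @cylinders_measurable _ _ GA; have mB := @cylinders_measurable _ _ GB.
case: GA => C [mC CT AE]; case: GB => D [mD DT BE].
rewrite -[LHS]fineK ?fin_num_measure//; last exact: measurableI.
rewrite -[in RHS](@fineK _ (P A)) ?fin_num_measure//.
rewrite -[in RHS](@fineK _ (P B)) ?fin_num_measure//.
rewrite -EFinM; congr EFin.
have -> : A `&` B = \bigcap_(i in [set: I]) (X i @^-1` (C i `&` D i)).
  by rewrite AE BE -bigcapI; apply: eq_bigcapr.
rewrite AE BE !XI//; last by move=> i; exact: measurableI.
rewrite -big_split/=; apply: eq_bigr => i _.
have [iJ|iJ] := boolP (i \in J1).
  by rewrite DT ?J12// setIT preimage_setT probability_setT mulr1.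
by rewrite CT// setTI preimage_setT probability_setT mul1r.
Qed.

Lemma measurable_cylinders (J : {set I}) i : i \in J ->
  measurable_fun setT (X i : g_sigma_algebraType (cylinders J) -> R * R).
Proof.
move=> iJ _ B mB; rewrite setTI; apply: sub_gen_smallest.
exists (fun j => if j == i then B else setT); split.
- by move=> j; case: ifPn.
- by move=> j jJ; case: ifPn => // /eqP ji; rewrite ji iJ in jJ.
- apply/seteqP; split=> [w Bw j _|w /(_ i Logic.I)] /=; last by rewrite eqxx.
  by case: ifPn => // /eqP ->.
Qed.

Lemma indep_disjoint {d1 d2} {U : measurableType d1} {V : measurableType d2}
    (J1 J2 : {set I}) (f : T -> U) (g : T -> V) :
  {in J1, forall i, i \notin J2} ->
  measurable_fun setT (f : g_sigma_algebraType (cylinders J1) -> U) ->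
  measurable_fun setT (g : g_sigma_algebraType (cylinders J2) -> V) ->
  indep P f g.
Proof.
move=> J12 mf mg A B mA mB; apply: cylinders_indep J12 _ _ _ _.
- by have := mf measurableT A mA; rewrite setTI.
- by have := mg measurableT B mB; rewrite setTI.
Qed.

End grouping.

(** * Joint laws and expectations of independent pairs *)

Section indep_law.
Context {d d1 d2} {T : measurableType d} {U : measurableType d1}
  {V : measurableType d2} {R : realType} (P : probability T R).
Local Open Scope ereal_scope.

(** Independence makes the joint law agree with the product of the marginals on rectangles;
    uniqueness of the product measure does the rest. *)
Lemma indep_law (f : {mfun T >-> U}) (g : {mfun T >-> V}) (X : set (U * V)) :
  indep P f g -> measurable X ->
  (distribution P f \x distribution P g) X = P ((fun w => (f w, g w)) @^-1` X).
Proof.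
move=> fg mX.
have mh : measurable_fun setT (fun w => (f w, g w)).
  by apply: measurable_fun_pair.
pose h : {mfun T >-> (U * V)%type} :=
  HB.pack (fun w => (f w, g w)) (isMeasurableFun.Build _ _ _ _ (fun w => (f w, g w)) mh).
rewrite (@product_measure_unique _ _ _ _ _ (distribution P f) (distribution P g)
  (distribution P h))//.
Qed.

Lemma indep_integral (f : {mfun T >-> U}) (g : {mfun T >-> V})
    (F : U * V -> \bar R) : indep P f g -> measurable_fun setT F ->
    (forall z, 0 <= F z) ->
  \int[distribution P f \x distribution P g]_z F z = \int[P]_w F (f w, g w).
Proof.
move=> fg mF F0.
have mh : measurable_fun setT (fun w => (f w, g w)).
  by apply: measurable_fun_pair.
pose h : {mfun T >-> (U * V)%type} :=
  HB.pack (fun w => (f w, g w)) (isMeasurableFun.Build _ _ _ _ (fun w => (f w, g w)) mh).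
transitivity (\int[distribution P h]_z F z).
  by apply: eq_measure_integral => A mA _; exact: indep_law.
by rewrite ge0_integral_distribution.
Qed.

End indep_law.

Section indep_expectation.
Context {d} {T : measurableType d} {R : realType} (P : probability T R).

(** First moments suffice: Tonelli applied to the absolute value gives integrability under the
    product law, and Fubini then factors the integral. *)
Lemma indep_integrableM_expectation (X Y : T -> R) :
  measurable_fun setT X -> measurable_fun setT Y -> indep P X Y ->
  P.-integrable setT (EFin \o X) -> P.-integrable setT (EFin \o Y) ->
  P.-integrable setT (EFin \o (fun w => X w * Y w)) /\
  \int[P]_w (X w * Y w) = (\int[P]_w X w) * (\int[P]_w Y w).
Proof.
move=> mX mY XY iX iY.
pose f : {mfun T >-> R} := HB.pack X (isMeasurableFun.Build _ _ _ _ X mX).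
pose g : {mfun T >-> R} := HB.pack Y (isMeasurableFun.Build _ _ _ _ Y mY).
pose F (z : R * R) := (z.1 * z.2)%:E.
have mF : measurable_fun setT F.
  by apply/measurable_EFinP; exact: measurable_funM.
have mh : measurable_fun setT (fun w => (f w, g w)).
  by apply: measurable_fun_pair.
pose h : {mfun T >-> (R * R)%type} :=
  HB.pack (fun w => (f w, g w)) (isMeasurableFun.Build _ _ _ _ (fun w => (f w, g w)) mh).
have mEFin : measurable_fun [set: R] (@EFin R) by [].
have iX' : (distribution P f).-integrable setT EFin.
  by apply/integrable_pushforward => //.
have iY' : (distribution P g).-integrable setT EFin.
  by apply/integrable_pushforward => //.
have iF : (distribution P f \x distribution P g)%E.-integrable setT F.
  apply/integrable12ltyP => //.
  under eq_integral => x _.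
    under eq_integral => y _ do rewrite /F/= normrM EFinM.
    rewrite ge0_integralZl//; last by apply: measurableT_comp => //; exact: measurableT_comp.
    over.
  rewrite ge0_integralZr//; [|by apply: measurableT_comp => //; exact: measurableT_comp
    |by apply: integral_ge0].
  case/integrableP : iX' => _ iX'; case/integrableP : iY' => _ iY'.
  rewrite lte_mul_pinfty// ?ge0_fin_numE// ?integral_ge0//.
have iXY : P.-integrable setT (EFin \o (fun w => X w * Y w)).
  case/integrableP : iF => _ iF.
  apply/integrableP; split.
    by apply/measurable_EFinP; exact: measurable_funM.
  rewrite (indep_integral (f := f) (g := g) (F := fun z => `|F z|%E)) in iF => //.
  exact: measurableT_comp.
split => //.
rewrite /Rintegral -fineM ?integrable_fin_num//; congr fine.
transitivity (\int[distribution P f \x distribution P g]_z F z)%E.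
  transitivity (\int[distribution P h]_z F z)%E.
    by rewrite integral_distribution.
  by apply: eq_measure_integral => A mA _; exact/esym/indep_law.
rewrite -integral12_prod_meas1//.
transitivity (\int[distribution P f]_x (x%:E * \int[P]_w (Y w)%:E))%E.
  apply: eq_integral => x _; rewrite /fubini_F/=.
  under eq_integral do rewrite /F/= EFinM.
  by rewrite integralZl// integral_distribution.
rewrite /= -(@fineK _ (\int[P]_w (Y w)%:E)%E) ?integrable_fin_num//.
by rewrite integralZr// integral_distribution.
Qed.

(** Equal marginals and independence force equal joint laws. This carries the Lindeberg condition,
    stated for cell 0, over to every cell. *)
Lemma indep_eq_integral (X Y X' Y' : T -> R) (F : R * R -> R) :
  measurable_fun setT X -> measurable_fun setT Y ->
  measurable_fun setT X' -> measurable_fun setT Y' ->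
  indep P X Y -> indep P X' Y' ->
  (forall B, measurable B -> P (X @^-1` B) = P (X' @^-1` B)) ->
  (forall B, measurable B -> P (Y @^-1` B) = P (Y' @^-1` B)) ->
  measurable_fun setT F -> (forall z, 0 <= F z) ->
  (\int[P]_w (F (X w, Y w))%:E = \int[P]_w (F (X' w, Y' w))%:E)%E.
Proof.
move=> mX mY mX' mY' iXY iXY' XX YY mF F0.
pose f : {mfun T >-> R} := HB.pack X (isMeasurableFun.Build _ _ _ _ X mX).
pose g : {mfun T >-> R} := HB.pack Y (isMeasurableFun.Build _ _ _ _ Y mY).
pose f' : {mfun T >-> R} := HB.pack X' (isMeasurableFun.Build _ _ _ _ X' mX').
pose g' : {mfun T >-> R} := HB.pack Y' (isMeasurableFun.Build _ _ _ _ Y' mY').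
have mEF : measurable_fun setT (EFin \o F) by exact/measurable_EFinP.
rewrite -(indep_integral (f := f) (g := g) (F := EFin \o F))//.
rewrite -(indep_integral (f := f') (g := g') (F := EFin \o F))//.
apply: eq_measure_integral => A mA _.
apply: product_measure_unique => // B C mB mC.
etransitivity; first exact: product_measure1E.
congr (_ * _)%E; [exact/esym/XX|exact/esym/YY].
Qed.

End indep_expectation.

Lemma indep_comp {d d1 d2 d3 d4} {T : measurableType d} {U : measurableType d1}
  {V : measurableType d2} {U' : measurableType d3} {V' : measurableType d4}
  {R : realType} (P : probability T R) (f : T -> U) (g : T -> V)
  (h : U -> U') (k : V -> V') :
  measurable_fun setT h -> measurable_fun setT k ->
  indep P f g -> indep P (h \o f) (k \o g).
Proof.
move=> mh mk fg A B mA mB; apply: (fg (h @^-1` A) (k @^-1` B)).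
  by rewrite -[X in measurable X]setTI; exact: mh.
by rewrite -[X in measurable X]setTI; exact: mk.
Qed.

(** * Integrability, second moments and Chebyshev's inequality *)

Section expectation.
Context {d} {T : measurableType d} {R : realType} (P : probability T R).
Implicit Types f g X Y : T -> R.

Lemma integrable_dom f g : measurable_fun setT f -> L1 P g ->
  (forall w, `|f w| <= g w) -> L1 P f.
Proof.
move=> mf ig fg; apply: (le_integrable measurableT _ _ ig).
  exact/measurable_EFinP.
by move=> w _ /=; rewrite lee_fin (le_trans (fg w))// ler_norm.
Qed.

Lemma integrable_cst (r : R) : L1 P (fun=> r).
Proof. exact: finite_measure_integrable_cst. Qed.

Lemma integrable_bounded f M : measurable_fun setT f ->
  (forall w, `|f w| <= M) -> L1 P f.
Proof. by move=> mf fM; apply: integrable_dom (integrable_cst M) fM. Qed.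

Lemma integrable_add f g : L1 P f -> L1 P g -> L1 P (fun w => f w + g w).
Proof. by move=> fi gi; exact: (integrableD measurableT fi gi). Qed.

Lemma integrable_sub f g : L1 P f -> L1 P g -> L1 P (fun w => f w - g w).
Proof. by move=> fi gi; exact: (integrableB measurableT fi gi). Qed.

Lemma integrable_scale r f : L1 P f -> L1 P (fun w => r * f w).
Proof. by move=> fi; exact: (integrableZl measurableT r fi). Qed.

Lemma integrable_bigsum (I : Type) (s : seq I) (F : I -> T -> R) :
  (forall i, L1 P (F i)) -> L1 P (fun w => \sum_(i <- s) F i w).
Proof.
move=> iF; elim: s => [|i s ih].
  by under eq_fun do rewrite big_nil; exact: integrable_cst.
by under eq_fun do rewrite big_cons; exact: integrable_add.
Qed.

Lemma Rintegral_bigsum (I : Type) (s : seq I) (F : I -> T -> R) :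
  (forall i, L1 P (F i)) ->
  \int[P]_w (\sum_(i <- s) F i w) = \sum_(i <- s) \int[P]_w F i w.
Proof.
move=> iF; elim: s => [|i s ih].
  rewrite big_nil; under eq_Rintegral do rewrite big_nil.
  by rewrite Rintegral_cst// mul0r.
rewrite big_cons; under eq_Rintegral do rewrite big_cons.
by rewrite RintegralD ?ih//; exact: integrable_bigsum.
Qed.

Lemma Rintegral_const (r : R) : \int[P]_w r = r.
Proof. by rewrite Rintegral_cst// (congr1 fine (probability_setT P)) mulr1. Qed.

Lemma ler_norm_Rintegral f g : measurable_fun setT f -> L1 P g ->
  (forall w, `|f w| <= g w) -> `|\int[P]_w f w| <= \int[P]_w g w.
Proof.
move=> mf ig fg; have fi := integrable_dom mf ig fg.
apply: (le_trans (le_normr_Rintegral measurableT fi)).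
by apply: le_Rintegral => //; exact: integrable_norm.
Qed.

Lemma sqr_integrable_integrable X : measurable_fun setT X ->
  L1 P (fun w => X w ^+ 2) -> L1 P X.
Proof.
move=> mX iX; apply: (integrable_dom mX (integrable_add (integrable_cst 1) iX)).
by move=> w; rewrite ler_norml; apply/andP; split; nra.
Qed.

Lemma sqr_integrable_mul X Y : measurable_fun setT X -> measurable_fun setT Y ->
  L1 P (fun w => X w ^+ 2) -> L1 P (fun w => Y w ^+ 2) ->
  L1 P (fun w => X w * Y w).
Proof.
move=> mX mY iX iY; apply: (integrable_dom _ (integrable_add iX iY)).
  exact: measurable_funM.
by move=> w; rewrite ler_norml; apply/andP; split; nra.
Qed.

Lemma indep_expectationM X Y : measurable_fun setT X -> measurable_fun setT Y ->
  indep P X Y -> L1 P X -> L1 P Y ->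
  \int[P]_w (X w * Y w) = (\int[P]_w X w) * (\int[P]_w Y w).
Proof. by move=> mX mY XY iX iY; case: (indep_integrableM_expectation mX mY XY iX iY). Qed.

Lemma second_moment_sum (I : finType) (x : I -> T -> R) :
  (forall i, measurable_fun setT (x i)) -> (forall i, L1 P (fun w => x i w ^+ 2)) ->
  (forall i j, i != j -> \int[P]_w (x i w * x j w) = 0) ->
  L1 P (fun w => (\sum_i x i w) ^+ 2) /\
  \int[P]_w ((\sum_i x i w) ^+ 2) = \sum_i \int[P]_w (x i w ^+ 2).
Proof.
move=> mx ix xx.
have ixx i j : L1 P (fun w => x i w * x j w) by exact: sqr_integrable_mul.
have sqE w : (\sum_i x i w) ^+ 2 = \sum_i \sum_j x i w * x j w.
  by rewrite expr2 mulr_suml; apply: eq_bigr => i _; rewrite mulr_sumr.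
split.
  under eq_fun do rewrite sqE.
  by apply: integrable_bigsum => i; exact: integrable_bigsum.
under eq_Rintegral do rewrite sqE.
rewrite Rintegral_bigsum; last by move=> i; exact: integrable_bigsum.
apply: eq_bigr => i _; rewrite Rintegral_bigsum// (bigD1 i)//= big1 ?addr0//.
by move=> j ji; rewrite xx// eq_sym.
Qed.

Lemma Rintegral_indic (A : set T) : measurable A -> \int[P]_w \1_A w = fine (P A).
Proof. by move=> mA; rewrite /Rintegral integral_indic// setIT. Qed.

Lemma integrable_indicator (A : set T) : measurable A -> L1 P \1_A.
Proof. by move=> mA; exact: integrable_indic. Qed.

Lemma fine_probability_le (A B : set T) : measurable A -> measurable B ->
  A `<=` B -> fine (P A) <= fine (P B).
Proof.
move=> mA mB AB; apply: fine_le; rewrite ?fin_num_measure//.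
by apply: le_measure; rewrite ?inE.
Qed.

Lemma fine_probabilityU (A B : set T) : measurable A -> measurable B ->
  fine (P (A `|` B)) <= fine (P A) + fine (P B).
Proof.
move=> mA mB; rewrite -fineD ?fin_num_measure//; apply: fine_le.
- by rewrite fin_num_measure//; exact: measurableU.
- by rewrite fin_numD !fin_num_measure.
- exact: measureU2.
Qed.

Lemma fine_probabilityUd (A B : set T) : measurable A -> measurable B ->
  A `&` B = set0 -> fine (P (A `|` B)) = fine (P A) + fine (P B).
Proof. by move=> mA mB AB; rewrite measureU// fineD// fin_num_measure. Qed.

Lemma chebyshev_sqr X (e : R) : 0 < e -> measurable_fun setT X ->
  L1 P (fun w => X w ^+ 2) ->
  fine (P [set w | e <= `|X w|]) <= (\int[P]_w (X w ^+ 2)) / e ^+ 2.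
Proof.
move=> e0 mX iX.
have mA : measurable [set w | e <= `|X w|].
  rewrite -[X in measurable X]setTI; apply: measurable_fun_le => //.
  exact: measurableT_comp.
rewrite ler_pdivlMr ?exprn_gt0// -Rintegral_indic// -RintegralZr//; last first.
  exact: integrable_indicator.
apply: le_Rintegral => //.
  by under eq_fun do rewrite mulrC; apply: integrable_scale; exact: integrable_indicator.
move=> w _; rewrite indicE; case: (boolP (w \in _)); last by rewrite mul0r sqr_ge0.
by rewrite inE/= => ew; rewrite mul1r -[leRHS]real_normK ?num_real// lerXn2r// nnegrE ltW.
Qed.

End expectation.

(** * Stein's method *)

Section stein.
Context {d} {T : measurableType d} {R : realType} (P : probability T R).
Variables (f f' : R -> R) (M M' e del : R).
Hypothesis df : forall x : R, is_derive x 1 f (f' x).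
Hypothesis f'_cont : continuous f'.
Hypothesis fM : forall x, `|f x| <= M'.
Hypothesis f'M : forall x, `|f' x| <= M.
Hypothesis del0 : 0 < del.
Hypothesis f'_ucont : forall x y, `|x - y| < del -> `|f' x - f' y| <= e.

Let f_cont : continuous f.
Proof. by move=> x; apply/differentiable_continuous/derivable1_diffP; case: (df x). Qed.

Let mf : measurable_fun setT f.
Proof. exact: continuous_measurable_fun. Qed.

Let mf' : measurable_fun setT f'.
Proof. exact: continuous_measurable_fun. Qed.

Let M0 : 0 <= M. Proof. exact: le_trans (f'M 0). Qed.

Let e0 : 0 <= e.
Proof. by have := @f'_ucont 0 0; rewrite !subrr normr0; apply. Qed.

(** Small increments use the modulus of continuity of [f'], large ones the crude bound [2 * M]; the
    two are added so that a single formula covers both. *)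
Let f'_diff v x : `|f' (x + v) - f' v| <= e + 2 * M * (if del <= `|x| then 1 else 0).
Proof.
case: ifPn => [dx|]; last by rewrite -ltNge => dx; rewrite mulr0 addr0 f'_ucont// addrK.
rewrite mulr1 (le_trans (ler_normB _ _))//.
by have := f'M (x + v); have := f'M v; have := e0; lra.
Qed.

(** By the mean value theorem the increment of [f] is [x * f' c] with [|c - v| <= |x|], and the
    bound of [f'_diff] is monotone in the size of the increment. *)
Let f_taylor v x : `|f (x + v) - f v - x * f' v| <=
  `|x| * (e + 2 * M * (if del <= `|x| then 1 else 0)).
Proof.
have [c cP ->] : exists2 c, Num.min v (x + v) <= c <= Num.max v (x + v) &
    f (x + v) - f v = x * f' c.
  have [x0|x0] := leP 0 x.
    have [c cI E] : exists2 c, c \in `[v, x + v] & f (x + v) - f v = f' c * (x + v - v).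
      apply: (MVT_segment _ (fun y _ => df y)); first by rewrite lerDr.
      exact/continuous_subspaceT.
    exists c; last by rewrite E addrK mulrC.
    by move: cI; rewrite in_itv/= min_l ?max_r ?lerDr.
  have [c cI E] : exists2 c, c \in `[x + v, v] & f v - f (x + v) = f' c * (v - (x + v)).
    apply: (MVT_segment _ (fun y _ => df y)); first by rewrite gerDr ltW.
    exact/continuous_subspaceT.
  exists c; last by rewrite -opprB E -mulrN opprB addrK mulrC.
  by move: cI; rewrite in_itv/= min_r ?max_l ?gerDr// ltW.
rewrite -mulrBr normrM ler_wpM2l//.
have cv : `|c - v| <= `|x|.
  have := cP; rewrite ler_norml; have := ler_norm x; have := ler_norm (- x).
  by rewrite normrN; case: (leP v (x + v)) => _; lra.
have := f'_diff v (c - v); rewrite subrK => /le_trans; apply.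
rewrite lerD2l ler_wpM2l ?mulr_ge0//.
by case: ifPn => [/le_trans/(_ cv) ->//|_]; case: ifP.
Qed.

(** [X] is one summand and [V] the sum of the others. The Taylor remainder costs
    [v * e + 2 * M * ell]; replacing [f' (V)] by [f' (X + V)] costs the last term, in which
    [v / del ^+ 2] is Chebyshev's bound on the probability that [|X|] reaches [del]. *)
Lemma stein_step (X V : T -> R) (v ell : R) :
  measurable_fun setT X -> measurable_fun setT V -> indep P X V ->
  L1 P (fun w => X w ^+ 2) -> \int[P]_w X w = 0 -> \int[P]_w (X w ^+ 2) = v ->
  \int[P]_w (if del <= `|X w| then X w ^+ 2 else 0) = ell ->
  `|\int[P]_w (X w * f (X w + V w)) - v * \int[P]_w f' (X w + V w)| <=
  v * e + 2 * M * ell + v * (e + 2 * M * (v / del ^+ 2)).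
Proof.
move=> mX mV XV iX2 EX EX2 Eell.
have iX := sqr_integrable_integrable mX iX2.
have mX2 : measurable_fun setT (fun w => X w ^+ 2) by exact: measurable_funX.
have mXV : measurable_fun setT (fun w => X w + V w) by exact: measurable_funD.
have mfV : measurable_fun setT (fun w => f (V w)) by exact: measurableT_comp.
have mfXV : measurable_fun setT (fun w => f (X w + V w)) by exact: measurableT_comp.
have mf'V : measurable_fun setT (fun w => f' (V w)) by exact: measurableT_comp.
have mf'XV : measurable_fun setT (fun w => f' (X w + V w)) by exact: measurableT_comp.
have mtr : measurable_fun setT (fun w => if del <= `|X w| then X w ^+ 2 else 0).
  apply: measurable_fun_ifT => //; apply: measurable_fun_ler => //.
  exact: measurableT_comp.
have itr : L1 P (fun w => if del <= `|X w| then X w ^+ 2 else 0).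
  apply: integrable_dom iX2 _ => // w; case: ifP => _.
    by rewrite ger0_norm// sqr_ge0.
  by rewrite normr0 sqr_ge0.
have ifV : L1 P (fun w => f (V w)) by apply: integrable_bounded => // w.
have if'V : L1 P (fun w => f' (V w)) by apply: integrable_bounded => // w.
have if'XV : L1 P (fun w => f' (X w + V w)) by apply: integrable_bounded => // w.
have [iXfV EXfV] := indep_integrableM_expectation mX mfV
  (indep_comp (@measurable_id _ _ setT) mf XV) iX ifV.
have [iXf'V EXf'V] := indep_integrableM_expectation mX2 mf'V
  (indep_comp (exprn_measurable 2) mf' XV) iX2 if'V.
have iXfXV : L1 P (fun w => X w * f (X w + V w)).
  apply: (integrable_dom _ (integrable_scale M' (integrable_norm iX))).
    exact: measurable_funM.
  by move=> w; rewrite normrM mulrC ler_wpM2r.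
(* By independence, the second term has mean 0 since [X] is centered, and the third has mean [v]
   times that of [f' (V)]. *)
pose r w := X w * f (X w + V w) - X w * f (V w) - X w ^+ 2 * f' (V w).
have mr : measurable_fun setT r.
  by apply: measurable_funB; [apply: measurable_funB|]; exact: measurable_funM.
have Er : \int[P]_w r w = \int[P]_w (X w * f (X w + V w)) - v * \int[P]_w f' (V w).
  rewrite /r RintegralB//; last exact: integrable_sub.
  by rewrite RintegralB// EXfV EXf'V EX EX2 mul0r subr0.
have rle w : `|r w| <= e * X w ^+ 2 + 2 * M * (if del <= `|X w| then X w ^+ 2 else 0).
  have -> : r w = X w * (f (X w + V w) - f (V w) - X w * f' (V w)) by rewrite /r; ring.
  rewrite normrM; have := f_taylor (V w) (X w) => /(ler_wpM2l (normr_ge0 (X w))).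
  move/le_trans; apply; rewrite mulrA -normrM -expr2 ger0_norm ?sqr_ge0//.
  by case: ifP => _; nra.
have irle := integrable_add (integrable_scale e iX2) (integrable_scale (2 * M) itr).
have := ler_norm_Rintegral mr irle rle.
rewrite Er RintegralD//; [|exact: integrable_scale|exact: integrable_scale].
rewrite !RintegralZl// EX2 Eell => B1.
(* The indicator of [del <= |X|] is dominated by [X ^+ 2 / del ^+ 2]. *)
have sle w : `|f' (V w) - f' (X w + V w)| <= e + 2 * M / del ^+ 2 * X w ^+ 2.
  rewrite distrC (le_trans (f'_diff _ _))// lerD2l -!mulrA ler_wpM2l// ler_wpM2l//.
  case: ifPn => dX; last by rewrite mulr_ge0 ?invr_ge0 ?sqr_ge0.
  rewrite mulrC ler_pdivlMr ?exprn_gt0// mul1r -[leRHS]real_normK ?num_real//.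
  by rewrite lerXn2r// nnegrE ltW.
have isle := integrable_add (integrable_cst P e) (integrable_scale (2 * M / del ^+ 2) iX2).
have := ler_norm_Rintegral (measurable_funB mf'V mf'XV) isle sle.
rewrite RintegralB// RintegralD//; [|exact: integrable_cst|exact: integrable_scale].
rewrite Rintegral_const RintegralZl// EX2 => B2.
have v0 : 0 <= v by rewrite -EX2; apply: Rintegral_ge0 => w _; exact: sqr_ge0.
rewrite [X in `|X|](_ : _ = (\int[P]_w (X w * f (X w + V w)) - v * \int[P]_w f' (V w)) +
  v * (\int[P]_w f' (V w) - \int[P]_w f' (X w + V w))); last by ring.
rewrite (le_trans (ler_normD _ _))// normrM (ger0_norm v0) lerD//.
  by rewrite [v * e]mulrC.
by rewrite ler_wpM2l// (le_trans B2)// lerD2l mulrAC !mulrA.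
Qed.

(** The bounds of [stein_step] with [v = 1 / n] are added over the [n] summands. The [e] terms add
    up to [2 * e], the truncated moments to the Lindeberg sum [n * ell], and the Chebyshev terms are
    of order [1 / n]. *)
Lemma stein_bound (n : nat) (xi : 'I_n -> T -> R) (ell : R) :
  (0 < n)%N ->
  (forall a, measurable_fun setT (xi a)) ->
  (forall a, indep P (xi a) (fun w => \sum_(b | b != a) xi b w)) ->
  (forall a, L1 P (fun w => xi a w ^+ 2)) ->
  (forall a, \int[P]_w xi a w = 0) ->
  (forall a, \int[P]_w (xi a w ^+ 2) = n%:R^-1) ->
  (forall a, \int[P]_w (if del <= `|xi a w| then xi a w ^+ 2 else 0) = ell) ->
  `|\int[P]_w ((\sum_a xi a w) * f (\sum_a xi a w)) - \int[P]_w f' (\sum_a xi a w)|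
  <= 2 * e + 2 * M * (n%:R * ell) + 2 * M / (n%:R * del ^+ 2).
Proof.
move=> n0 mxi ixi xi2 Exi Exi2 Eell.
have nn0 : n%:R != 0 :> R by rewrite pnatr_eq0 -lt0n.
set W := fun w => \sum_a xi a w.
have WE a w : W w = xi a w + \sum_(b | b != a) xi b w by rewrite /W (bigD1 a).
have mV a : measurable_fun setT (fun w => \sum_(b | b != a) xi b w).
  by under eq_fun do rewrite -big_filter; exact: measurable_sum.
have mW : measurable_fun setT W by exact: measurable_sum.
have ixf a : L1 P (fun w => xi a w * f (W w)).
  apply: (integrable_dom _ (integrable_scale M' (integrable_norm
    (sqr_integrable_integrable (mxi a) (xi2 a))))).
    by apply: measurable_funM => //; exact: measurableT_comp.
  by move=> w; rewrite normrM mulrC ler_wpM2r.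
have -> : \int[P]_w (W w * f (W w)) = \sum_a \int[P]_w (xi a w * f (W w)).
  by rewrite -Rintegral_bigsum//; apply: eq_Rintegral => w _; rewrite mulr_suml.
have -> : \int[P]_w f' (W w) = \sum_(a < n) n%:R^-1 * \int[P]_w f' (W w).
  by rewrite sumr_const card_ord -(mulr_natl (n%:R^-1 * _)) mulrA divff// mul1r.
rewrite -sumrB (le_trans (ler_norm_sum _ _ _))//.
apply: (@le_trans _ _ (\sum_(a < n) (n%:R^-1 * e + 2 * M * ell +
    n%:R^-1 * (e + 2 * M * (n%:R^-1 / del ^+ 2))))).
  apply: ler_sum => a _.
  have := stein_step (mxi a) (mV a) (ixi a) (xi2 a) (Exi a) (Exi2 a) (Eell a).
  under eq_Rintegral do rewrite -WE.
  by under [in X in _ - _ * X]eq_Rintegral do rewrite -WE.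
rewrite sumr_const card_ord -(mulr_natl (_ + _)) le_eqVlt; apply/orP; left; apply/eqP.
by field; rewrite nn0 gt_eqF.
Qed.

End stein.

(** * Gaussian means of trapezoids and the Stein equation *)

Section normal_cdf.
Context {R : realType}.
Implicit Types x y : R.
Local Notation mu := (@lebesgue_measure R).
Local Notation N := (@normal_prob R 0 1).
Local Notation phi := (@normal_pdf R 0 1).

Definition Phi x : R := fine (N `]-oo, x]).

Lemma phiN x : phi (- x) = phi x.
Proof. by rewrite !normal_pdfE ?oner_neq0//= /normal_fun !subr0 sqrrN. Qed.

Lemma normal_prob_set1 x : N [set x] = 0%E.
Proof.
have /null_content_dominatesP := normal_prob_dominates (0 : R) 1; apply => //.
exact: lebesgue_measure_set1.
Qed.

(** Reflection maps the left tail to [[x, +oo[], whose endpoint carries no mass. *)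
Lemma PhiN x : Phi (- x) = 1 - Phi x.
Proof.
have sym : N `]-oo, - x] = N `[x, +oo[.
  rewrite /normal_prob ge0_integration_by_substitutionNy.
  - by apply: eq_integral => y _; rewrite /= phiN.
  - by apply: continuous_subspaceT; exact: continuous_normal_pdf.
  - by move=> y _; exact: normal_pdf_ge0.
have N1 : fine (N [set: R]) = 1 by exact: (congr1 fine (probability_setT N)).
have E : fine (N [set: R]) = Phi x + fine (N `]x, +oo[).
  have -> : [set: R] = `]-oo, x] `|` `]x, +oo[.
    by rewrite -(itv_bndbnd_setU (x := BRight x))// set_itvNyy.
  apply: fine_probabilityUd => //.
  by rewrite -subset0 => y [] /=; rewrite !in_itv/= andbT => /le_lt_trans h/h; rewrite ltxx.
have F : fine (N `[x, +oo[) = fine (N [set x]) + fine (N `]x, +oo[).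
  have -> : `[x, +oo[%classic = [set x] `|` `]x, +oo[ by rewrite setU1itv.
  apply: fine_probabilityUd => //.
  by rewrite -subset0 => y [] /= ->; rewrite in_itv/= ltxx.
have -> : Phi (- x) = fine (N `[x, +oo[) by rewrite /Phi sym.
have F0 : fine (N [set x]) = 0 by rewrite normal_prob_set1.
by move: E; rewrite N1 F F0; lra.
Qed.

Lemma Phi_itv x y : x <= y -> fine (N `]x, y]) = Phi y - Phi x.
Proof.
move=> xy; have -> : Phi y = Phi x + fine (N `]x, y]).
  rewrite /Phi (_ : `]-oo, y]%classic = `]-oo, x] `|` `]x, y]).
    apply: fine_probabilityUd => //.
    by rewrite -subset0 => z [] /=; rewrite !in_itv/= => /le_lt_trans h /andP[/h]; rewrite ltxx.
  by rewrite -(itv_bndbnd_setU (x := BRight x)).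
by rewrite addrAC subrr add0r.
Qed.

Lemma Phi_nd x y : x <= y -> Phi x <= Phi y.
Proof. by move=> xy; rewrite -subr_ge0 -Phi_itv// fine_ge0. Qed.

(** The density is at most its peak [normal_peak 1]. *)
Lemma Phi_lipschitz x y : x <= y -> Phi y <= Phi x + normal_peak 1 * (y - x).
Proof.
move=> xy; rewrite -lerBlDl -Phi_itv// -lee_fin fineK ?fin_num_measure//.
apply: (@le_trans _ _ (\int[mu]_(z in `]x, y]) (normal_peak 1)%:E)%E).
  apply: ge0_le_integral => //=.
  - by move=> z _; rewrite lee_fin normal_pdf_ge0.
  - apply/measurable_EFinP; apply: measurable_funTS; exact: measurable_normal_pdf.
  - by move=> z _; rewrite lee_fin normal_pdf_ub ?oner_neq0.
rewrite integral_cst//= lebesgue_measure_itv/= lte_fin; case: ifPn => [_|].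
  by rewrite -EFinD -EFinM.
by rewrite mule0 lee_fin mulr_ge0 ?normal_peak_ge0// subr_ge0.
Qed.

Lemma Phi_le1 x : Phi x <= 1.
Proof. by rewrite -lee_fin fineK ?fin_num_measure// probability_le1. Qed.

Lemma Phi_gt_half x : 2^-1 < Phi x -> 0 < x.
Proof.
move=> h; rewrite ltNge; apply/negP => /Phi_nd.
by have := PhiN 0; rewrite oppr0; lra.
Qed.

(** The extra requirement [e^-1 <= x] makes the Chebyshev error at level [x] small together with the
    Gaussian tail. *)
Lemma Phi_near1 (e : R) : 0 < e -> exists2 x, e^-1 <= x & 1 - e < Phi x.
Proof.
move=> e0.
pose F (n : nat) : set R := `]-oo, n%:R]%classic.
have cv : (fun n => N (F n)) @ \oo --> N (\bigcup_n F n).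
  apply: nondecreasing_cvg_mu; [by move=> n; exact: measurable_itv| |].
    by apply: bigcup_measurable => n _; exact: measurable_itv.
  move=> m n mn; apply/subsetPset => x /=.
  by rewrite /F/= !in_itv/= => /le_trans; apply; rewrite ler_nat.
have UT : \bigcup_n F n = setT.
  apply/seteqP; split => // x _; exists (Num.truncn `|x|).+1 => //=.
  by rewrite /F/= in_itv/= (le_trans (ler_norm x))// ltW// truncnS_gt.
have cvP : (fun n => Phi n%:R) @ \oo --> (1 : R).
  have NU : N (\bigcup_n F n) = 1%E by rewrite UT; exact: (probability_setT N).
  by apply: fine_cvg; move: cv; rewrite NU.
move/cvgrPdist_lt : cvP => /(_ e e0)[n _ nP].
have [m mP] : exists m : nat, (n <= m)%N /\ e^-1 <= m%:R.
  exists (maxn n (Num.truncn e^-1).+1); rewrite leq_maxl; split => //.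
  by apply: ltW; apply: (lt_le_trans (truncnS_gt _)); rewrite ler_nat leq_maxr.
exists m%:R; first exact: mP.2.
have := nP m mP.1; rewrite /= ger0_norm ?subr_ge0 ?Phi_le1//; lra.
Qed.

End normal_cdf.

(** * Trapezoids and their Gaussian means *)

Section trapezoid.
Context {R : realType}.
Local Notation mu := (@lebesgue_measure R).
Local Notation N := (@normal_prob R 0 1).
Local Notation phi := (@normal_pdf R 0 1).
Implicit Types a b x : R.

(** A continuous substitute for an indicator: for [0 < b] it is 1 where [|x| <= a], 0 where
    [|x| >= a + b], and affine in [|x|] in between. *)
Definition trap a b x : R := Num.max 0 (Num.min 1 ((a + b - `|x|) / b)).

Lemma trap_ge0 a b x : 0 <= trap a b x.
Proof. by rewrite /trap le_max lexx. Qed.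

Lemma trap_le1 a b x : trap a b x <= 1.
Proof. by rewrite /trap ge_max ler01 ge_min lexx. Qed.

Lemma trap_in a b x : 0 < b -> `|x| <= a -> trap a b x = 1.
Proof.
move=> b0 xa; rewrite /trap min_l ?max_r//.
by rewrite ler_pdivlMr// mul1r; lra.
Qed.

Lemma trap_out a b x : 0 < b -> a + b <= `|x| -> trap a b x = 0.
Proof.
move=> b0 xa; rewrite /trap max_l// ge_min; apply/orP; right.
by rewrite pmulr_lle0 ?invr_gt0// subr_le0.
Qed.

Lemma trap_continuous a b : continuous (trap a b).
Proof.
have c1 : continuous (fun x : R => (a + b - `|x|) / b).
  move=> x; apply: cvgM; last exact: cvg_cst.
  by apply: cvgB; [exact: cvg_cst|exact: norm_continuous].
move=> x; have c2 := @continuous_min R R (cst 1) _ x (@cst_continuous _ _ _ _) (c1 x).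
exact: (@continuous_max R R (cst 0) _ x (@cst_continuous _ _ _ _) c2).
Qed.

Lemma trap_measurable a b : measurable_fun setT (trap a b).
Proof. by apply: continuous_measurable_fun; exact: trap_continuous. Qed.

Lemma trap_phi_integrable a b : L1 mu (fun x => trap a b x * phi x).
Proof.
apply: (le_integrable measurableT _ _ (integrable_normal_pdf 0 1)).
  apply/measurable_EFinP; apply: measurable_funM; first exact: trap_measurable.
  exact: measurable_normal_pdf.
by move=> x _ /=; rewrite lee_fin normrM ger0_norm ?trap_ge0// ler_piMl// trap_le1.
Qed.

Definition normal_trap a b : R := \int[mu]_x (trap a b x * phi x).

Lemma normal_prob_Rintegral (A : set R) : measurable A ->
  fine (N A) = \int[mu]_x (\1_A x * phi x).
Proof.
move=> mA; rewrite /normal_prob integral_mkcond; congr fine.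
apply: eq_integral => x _; rewrite /patch indicE.
by case: ifPn => _; rewrite ?mul1r ?mul0r.
Qed.

Lemma indic_phi_integrable (A : set R) : measurable A ->
  L1 mu (fun x => \1_A x * phi x).
Proof.
move=> mA; apply: (le_integrable measurableT _ _ (integrable_normal_pdf 0 1)).
  apply/measurable_EFinP; apply: measurable_funM; first exact: measurable_indic.
  exact: measurable_normal_pdf.
move=> x _ /=; rewrite lee_fin normrM indicE ler_piMl//.
by case: (_ \in _); rewrite ?normr1 ?normr0.
Qed.

Lemma normal_prob_sym a : 0 <= a -> fine (N `]- a, a]) = 2 * Phi a - 1.
Proof. by move=> a0; rewrite Phi_itv ?PhiN ?ge0_cp//; lra. Qed.

Lemma normal_trap_lb a b : 0 < b -> 0 <= a -> 2 * Phi a - 1 <= normal_trap a b.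
Proof.
move=> b0 a0; rewrite -normal_prob_sym// normal_prob_Rintegral//.
apply: le_Rintegral => //; [exact: indic_phi_integrable|exact: trap_phi_integrable|].
move=> x _; rewrite ler_wpM2r ?normal_pdf_ge0// indicE.
case: (boolP (x \in _)) => [|_]; last exact: trap_ge0.
rewrite inE/= in_itv/= => /andP[xa ax]; rewrite trap_in// ler_norml; lra.
Qed.

Lemma normal_trap_ub a b : 0 < b -> 0 <= a + b -> normal_trap a b <= 2 * Phi (a + b) - 1.
Proof.
move=> b0 a0; rewrite -normal_prob_sym// normal_prob_Rintegral//.
apply: le_Rintegral => //; [exact: trap_phi_integrable|exact: indic_phi_integrable|].
move=> x _; rewrite ler_wpM2r ?normal_pdf_ge0// indicE.
have [xab|xab] := ltP `|x| (a + b); last by rewrite trap_out//.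
rewrite mem_set ?trap_le1//= in_itv/=.
by move: xab; rewrite ltr_norml => /andP[-> /ltW].
Qed.

Lemma normal_trap_ge0 a b : 0 <= normal_trap a b.
Proof. by apply: Rintegral_ge0 => x _; rewrite mulr_ge0 ?trap_ge0 ?normal_pdf_ge0. Qed.

Lemma normal_trap_le1 a b : normal_trap a b <= 1.
Proof.
have <- : \int[mu]_x phi x = 1 by rewrite /Rintegral integral_normal_pdf.
apply: le_Rintegral => //; [exact: trap_phi_integrable|exact: integrable_normal_pdf|].
by move=> x _; rewrite ler_piMl ?normal_pdf_ge0 ?trap_le1.
Qed.

End trapezoid.

(** * Continuous functions with compact support *)

Section compact_support.
Context {R : realType}.
Variables (h : R -> R) (A : R).
Hypothesis ch : continuous h.
Hypothesis h0 : forall x, A <= `|x| -> h x = 0.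

Lemma compact_support_bounded : exists M : R, forall x, `|h x| <= M.
Proof.
(* The segment is cut at [|A|] instead of [A] so that it is nonempty whatever the sign of [A]. *)
have cn : {within `[- `|A|, `|A|], continuous (fun x => `|h x|)}.
  apply: continuous_subspaceT => x.
  by apply: continuous_comp; [exact: ch|exact: norm_continuous].
have A0 : - `|A| <= `|A| by rewrite ge0_cp.
have [c _ cM] := EVT_max A0 cn.
exists `|h c| => x; have [xA|xA] := leP `|x| `|A|.
  by apply: cM; rewrite in_itv/= -ler_norml.
by rewrite h0 ?normr0// (le_trans (ler_norm A))// ltW.
Qed.

(** Heine's argument by near-covering compactness. The modulus obtained on the segment allows the
    second point to be anywhere on the line, so the one remaining case has both points outside,
    where [h] vanishes. *)
Lemma compact_support_uniformly_continuous (e : R) : 0 < e ->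
  exists2 del, 0 < del & forall x y, `|x - y| < del -> `|h x - h y| <= e.
Proof.
move=> e0.
have /compact_near_coveringP ncK := @segment_compact R (- `|A|) `|A|.
have : \forall del \near (0 : R)^'+, `[- `|A|, `|A|] `<=`
    (fun x => forall y, `|x - y| < del -> `|h x - h y| <= e).
  apply: ncK => x _.
  have /cvgrPdist_lt/(_ (e / 2)) : h y @[y --> x] --> h x by exact: ch.
  rewrite divr_gt0// => /(_ isT)/nbhs_ballP[r /= r0 xr].
  exists (ball x (r / 2), [set del | del < r / 2]) => /=.
    split; first by apply: nbhsx_ballx; rewrite divr_gt0.
    by apply: nbhs_right_lt; rewrite divr_gt0.
  move=> [x' del] [/= xx' dr] y x'y.
  have hx' : `|h x - h x'| < e / 2.
    by apply: xr; apply: le_ball xx'; lra.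
  have hy : `|h x - h y| < e / 2.
    apply: xr; rewrite /ball/= -(subrK x' x) -addrA (le_lt_trans (ler_normD _ _))//.
    by move: xx'; rewrite /ball/=; lra.
  rewrite -(subrK (h x) (h x')) -addrA (le_trans (ler_normD _ _))//.
  by rewrite distrC; lra.
move=> near_del; near ((0 : R)^'+) => del.
exists del; first by near: del; exact: nbhs_right_gt.
have delP : `[- `|A|, `|A|] `<=`
    (fun x => forall y, `|x - y| < del -> `|h x - h y| <= e) by near: del.
move=> x y xy.
have [xA|xA] := leP `|x| `|A|; first by apply: delP => //=; rewrite in_itv/= -ler_norml.
have [yA|yA] := leP `|y| `|A|.
  by rewrite distrC delP 1?distrC//= in_itv/= -ler_norml.
have out z : `|A| < `|z| -> h z = 0 by move=> zA; rewrite h0// (le_trans (ler_norm A))// ltW.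
by rewrite !out// subrr normr0 ltW.
Unshelve. all: by end_near. Qed.

End compact_support.

(** * The Stein equation for a centered, compactly supported right-hand side *)

Section stein_solution.
Context {R : realType}.
Local Notation mu := (@lebesgue_measure R).
Local Notation phi := (@normal_pdf R 0 1).
Variables (g : R -> R) (A : R).
Hypothesis cg : continuous g.
Hypothesis g0 : forall x, A <= `|x| -> g x = 0.
Hypothesis g_centered : \int[mu]_x (g x * phi x) = 0.

Let c : R := normal_peak 1.
Let c0 : 0 < c. Proof. by rewrite normal_peak_gt0 ?oner_neq0. Qed.

Let gphi_int : L1 mu (fun x => g x * phi x).
Proof.
have [M gM] := compact_support_bounded cg g0.
have := integrableZl measurableT M (integrable_normal_pdf (0 : R) 1).
apply: le_integrable => //.
  apply/measurable_EFinP; apply: measurable_funM; last exact: measurable_normal_pdf.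
  exact: continuous_measurable_fun.
by move=> x _ /=; rewrite lee_fin !normrM ler_wpM2r// (le_trans (gM x))// ler_norm.
Qed.

Let G (x : R) : R := \int[mu]_(t in `]-oo, x]) (g t * phi t).

Let dG (x : R) : is_derive x 1 G (g x * phi x).
Proof.
have cgphi : {for x, continuous (fun x => g x * phi x)}.
  by apply: cvgM; [exact: cg|exact: continuous_normal_pdf].
have xx1 : x < x + 1 by rewrite ltrDl.
have ix : mu.-integrable `]-oo, x + 1] (EFin \o (fun x => g x * phi x)).
  exact: (integrableS measurableT).
have [dG GE] := continuous_FTC1 xx1 ix (ltNyr _) cgphi.
by apply: (DeriveDef dG); rewrite -derive1E GE.
Qed.

(** To the left of the support the integrand is zero. To the right, [G x] is already the whole
    integral, which is zero by [g_centered]. *)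
Let G_out x : A <= `|x| -> G x = 0.
Proof.
move=> Ax; have [x0|x0] := leP x 0.
  rewrite /G (_ : \int[mu]_(t in _) _ = \int[mu]_(t in `]-oo, x]) 0).
    by rewrite Rintegral_cst// mul0r.
  apply: eq_Rintegral => t; rewrite inE/= in_itv/= => tx; rewrite g0 ?mul0r//.
  by rewrite (le_trans Ax)// !ler0_norm ?lerN2// (le_trans tx).
have : \int[mu]_(t in `]-oo, x] `|` `]x, +oo[) (g t * phi t) = 0.
  by rewrite -(itv_bndbnd_setU (x := BRight x))// set_itvNyy.
have iU : mu.-integrable (`]-oo, x] `|` `]x, +oo[) (EFin \o (fun x => g x * phi x)).
  by apply: (integrableS measurableT) => //; exact: measurableU.
rewrite Rintegral_setU//; last first.
  apply/disj_setPS => z [] /=; rewrite !in_itv/= andbT => /le_lt_trans h/h; rewrite ltxx//.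
rewrite -/(G x) (_ : \int[mu]_(t in `]x, +oo[) _ = \int[mu]_(t in `]x, +oo[) 0).
  by rewrite Rintegral_cst// mul0r addr0.
apply: eq_Rintegral => t; rewrite inE/= in_itv/= andbT => tx; rewrite g0 ?mul0r//.
by rewrite (le_trans Ax)// !gtr0_norm ?(ltW tx)// (lt_trans x0).
Qed.

(** The reciprocal of the normal density, in a closed form that is easy to differentiate. *)
Let u (x : R) : R := c^-1 * expR (x ^+ 2 / 2).

Let du (x : R) : is_derive x 1 u (x * u x).
Proof.
have d2 : is_derive x (1 : R) (fun y : R => y ^+ 2 / 2) x.
  have -> : (fun y : R => y ^+ 2 / 2) = (2^-1 : R) \*: (fun y : R => y ^+ 2).
    by apply/funext => y /=; rewrite mulrC.
  by apply: is_derive_eq; rewrite /GRing.scale/=; field.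
have de : is_derive x (1 : R) (fun y : R => expR (y ^+ 2 / 2)) (x * expR (x ^+ 2 / 2)).
  have := @is_derive1_comp R expR (fun y : R => y ^+ 2 / 2) x _ _ (is_derive_expR _) d2.
  by rewrite mulrC.
have -> : u = c^-1 \*: (fun y : R => expR (y ^+ 2 / 2)) by [].
by apply: is_derive_eq; rewrite /= /GRing.scale/=; ring.
Qed.

Let uphi x : u x * phi x = 1.
Proof.
rewrite normal_pdfE ?oner_neq0//= /normal_fun subr0 expr1n /u mulrACA mulVf ?gt_eqF// mul1r.
by rewrite -expRD mulNr subrr expR0.
Qed.

Lemma stein_solution : exists f f' : R -> R,
  [/\ forall x : R, is_derive x 1 f (f' x), continuous f',
      forall x, f' x - x * f x = g x,
      (exists M : R, forall x, `|f x| <= M) & (exists M : R, forall x, `|f' x| <= M)] /\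
  forall e : R, 0 < e ->
    exists2 del, 0 < del & forall x y, `|x - y| < del -> `|f' x - f' y| <= e.
Proof.
(* Defining [f'] by the equation itself lets it inherit continuity and compact support from [f] and
   [g]; only the derivative of [G * u] has to be computed. *)
pose f x := G x * u x; pose f' x := x * f x + g x.
have df (x : R) : is_derive x (1 : R) f (f' x).
  have := @is_deriveM R R G u x 1 _ _ (dG x) (du x).
  move/is_derive_eq; apply; rewrite /f' /f /GRing.scale/=.
  have -> : G x * (x * u x) + u x * (g x * phi x) =
    x * (G x * u x) + g x * (u x * phi x) by ring.
  by rewrite uphi mulr1.
have cf : continuous f.
  by move=> x; apply/differentiable_continuous/derivable1_diffP; case: (df x).
have cf' : continuous f'.
  by move=> x; apply: cvgD; [apply: cvgM; [exact: cvg_id|exact: cf]|exact: cg].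
have f0 x : A <= `|x| -> f x = 0 by move=> Ax; rewrite /f G_out// mul0r.
have f'0 x : A <= `|x| -> f' x = 0 by move=> Ax; rewrite /f' f0// g0// mulr0 addr0.
exists f, f'; split; last by move=> e; exact: (compact_support_uniformly_continuous cf' f'0).
split => //; [by move=> x; rewrite /f'; ring|exact: (compact_support_bounded cf f0)|].
exact: (compact_support_bounded cf' f'0).
Qed.

End stein_solution.

(** * Convergence of the means of trapezoids *)

Section trap_expectation.
Context {d} {T : measurableType d} {R : realType} (P : probability T R).
Variable W : T -> R.
Hypothesis mW : measurable_fun setT W.

Lemma trap_expectation_integrable (a b : R) : L1 P (fun w => trap a b (W w)).
Proof.
apply: (@integrable_bounded _ _ _ P _ 1).
  by apply: measurableT_comp => //; exact: trap_measurable.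
by move=> w; rewrite ger0_norm ?trap_ge0 ?trap_le1.
Qed.

(** A form of Chebyshev's inequality: [1 - x ^+ 2 / a ^+ 2] lies below the trapezoid, being negative
    where [|x| > a]. *)
Lemma trap_expectation_lb (a b : R) : 0 < b -> 0 < a -> L1 P (fun w => W w ^+ 2) ->
  \int[P]_w (W w ^+ 2) = 1 -> 1 - (a ^+ 2)^-1 <= \int[P]_w trap a b (W w).
Proof.
move=> b0 a0 iW2 EW2.
have -> : 1 - (a ^+ 2)^-1 = \int[P]_w (1 - (a ^+ 2)^-1 * W w ^+ 2).
  rewrite RintegralB//; [|exact: integrable_cst|exact: integrable_scale].
  by rewrite RintegralZl// Rintegral_const EW2 mulr1.
apply: le_Rintegral => //.
- by apply: integrable_sub; [exact: integrable_cst|exact: integrable_scale].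
- exact: trap_expectation_integrable.
move=> w _; have [Wa|Wa] := leP `|W w| a.
  by rewrite trap_in// lerBlDl lerDr mulr_ge0 ?sqr_ge0// invr_ge0 sqr_ge0.
apply: (@le_trans _ _ 0); last exact: trap_ge0.
rewrite subr_le0 mulrC ler_pdivlMr ?exprn_gt0// mul1r -[leRHS]real_normK ?num_real//.
by rewrite lerXn2r ?nnegrE// ltW.
Qed.

End trap_expectation.

Section trap_limit.
Context {d} {T : nat -> measurableType d} {R : realType}.
Variables (P : forall m, probability (T m) R) (W : forall m, T m -> R).
Arguments W : clear implicits.
Hypothesis mW : forall m, measurable_fun setT (W m).
Hypothesis W2 : \forall m \near \oo,
  L1 (P m) (fun w => W m w ^+ 2) /\ \int[P m]_w (W m w ^+ 2) = 1.
Hypothesis stein : forall f f' : R -> R, (forall x : R, is_derive x 1 f (f' x)) ->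
  continuous f' -> (exists M : R, forall x, `|f x| <= M) ->
  (exists M : R, forall x, `|f' x| <= M) ->
  (forall e : R, 0 < e ->
    exists2 del, 0 < del & forall x y, `|x - y| < del -> `|f' x - f' y| <= e) ->
  (fun m => \int[P m]_w (W m w * f (W m w)) - \int[P m]_w f' (W m w))
    @ \oo --> (0 : R).

(* The Stein equation is solved for [trap a b - lam * trap L 1] instead of
   [trap a b] minus its Gaussian mean, so that its solution has compact support;
   [lam] is close to the Gaussian mean of [trap a b] when [L] is large. *)
Lemma trap_difference_cvg (a b L : R) : 0 < b -> 0 < L ->
  0 < normal_trap L 1 ->
  (fun m => \int[P m]_w trap a b (W m w) -
    normal_trap a b / normal_trap L 1 * \int[P m]_w trap L 1 (W m w))
  @ \oo --> (0 : R).
Proof.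
move=> b0 L0 nL0; set lam := _ / _.
pose g x := trap a b x - lam * trap L 1 x.
have cg : continuous g.
  move=> x; apply: cvgB; first exact: trap_continuous.
  by apply: cvgM; [exact: cvg_cst|exact: trap_continuous].
have g0 x : Num.max (a + b) (L + 1) <= `|x| -> g x = 0.
  rewrite ge_max => /andP[xa xL].
  by rewrite /g !trap_out// mulr0 subr0.
have gc : \int[lebesgue_measure]_x (g x * normal_pdf 0 1 x) = 0.
  under eq_Rintegral do rewrite /g mulrBl -mulrA.
  rewrite RintegralB//; [|exact: trap_phi_integrable|]; last first.
    exact: (integrableZl measurableT lam (trap_phi_integrable L 1)).
  rewrite RintegralZl//; last exact: trap_phi_integrable.
  by rewrite -/(normal_trap a b) -/(normal_trap L 1) /lam divfK ?subrr// gt_eqF.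
have [f [f' [[df cf' ff' [M fM] f'M] f'uc]]] := stein_solution cg g0 gc.
have := stein df cf' (ex_intro _ M fM) f'M f'uc.
move/cvgN; rewrite oppr0; apply: cvg_trans; apply: near_eq_cvg.
near=> m.
have [iW2 _] : L1 (P m) (fun w => W m w ^+ 2) /\ \int[P m]_w (W m w ^+ 2) = 1.
  by near: m.
have mf : measurable_fun setT (fun w => f (W m w)).
  apply: measurableT_comp => //; apply: continuous_measurable_fun => x.
  by apply/differentiable_continuous/derivable1_diffP; case: (df x).
have mf' : measurable_fun setT (fun w => f' (W m w)).
  by apply: measurableT_comp => //; exact: continuous_measurable_fun.
have [M' f'M'] := f'M.
have if' : L1 (P m) (fun w => f' (W m w)) by apply: integrable_bounded => //.
have iWf : L1 (P m) (fun w => W m w * f (W m w)).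
  have iMW := integrable_scale M (integrable_norm (sqr_integrable_integrable (@mW m) iW2)).
  apply: (@integrable_dom _ _ _ _ _ (fun w => M * `|W m w|)) => //.
    exact: measurable_funM.
  by move=> w; rewrite normrM mulrC ler_wpM2r.
transitivity (\int[P m]_w f' (W m w) - \int[P m]_w (W m w * f (W m w))); first exact: opprB.
rewrite -RintegralB//.
rewrite -RintegralZl//; last exact: trap_expectation_integrable.
rewrite -RintegralB//; [|exact: trap_expectation_integrable|]; last first.
  by apply: integrable_scale; exact: trap_expectation_integrable.
by apply: eq_Rintegral => w _; rewrite ff'.
Unshelve. all: by end_near. Qed.

(** The wide trapezoid has mean within [eta] of 1 both under [W] and under the Gaussian law, so the
    ratio of these means is within [2 * eta] of 1. With the error [eta] from [trap_difference_cvg]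
    the total is at most [3 * eta]. *)
Lemma trap_expectation_cvg (a b : R) : 0 < b ->
  (fun m => \int[P m]_w trap a b (W m w)) @ \oo --> normal_trap a b.
Proof.
move=> b0; apply/cvgrPdist_le => e e0.
(* The bound [1 / 2] keeps the Gaussian mean of the wide trapezoid at least [1 / 2], so that
   dividing by it at most doubles an error. *)
pose eta := Num.min (e / 4) 2^-1.
have eta0 : 0 < eta by rewrite lt_min; apply/andP; split; lra.
have eta_e : eta <= e / 4 by rewrite ge_min lexx.
have eta_2 : eta <= 2^-1 by rewrite ge_min lexx orbT.
have [L LL PhiL] : exists2 x, (eta / 2)^-1 <= x & 1 - eta / 2 < Phi x.
  by apply: Phi_near1; rewrite divr_gt0.
have L0 : 0 < L by apply: lt_le_trans LL; rewrite invr_gt0 divr_gt0.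
have Leta : (L ^+ 2)^-1 <= eta.
  have L1 : 1 <= L by apply: le_trans LL; rewrite -invr1 lef_pV2 ?posrE ?divr_gt0//; lra.
  have : L^-1 <= eta / 2 by rewrite -[leRHS]invrK lef_pV2 ?posrE ?invr_gt0 ?divr_gt0.
  have : (L ^+ 2)^-1 <= L^-1 by rewrite lef_pV2 ?posrE ?exprn_gt0// expr2 ler_peMr// ltW.
  lra.
have nL : 1 - eta <= normal_trap L 1.
  by apply: le_trans (normal_trap_lb ltr01 (ltW L0)); lra.
have nL0 : 0 < normal_trap L 1 by lra.
have nL1 := normal_trap_le1 L (1 : R).
have := trap_difference_cvg a b0 L0 nL0.
move/cvgrPdist_le/(_ _ eta0) => near_eta.
near=> m.
have [iW2 EW2] : L1 (P m) (fun w => W m w ^+ 2) /\ \int[P m]_w (W m w ^+ 2) = 1.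
  by near: m.
have : `|0 - (\int[P m]_w trap a b (W m w) -
    normal_trap a b / normal_trap L 1 * \int[P m]_w trap L 1 (W m w))| <= eta by near: m.
have plb := trap_expectation_lb (P := P m) (@mW m) ltr01 L0 iW2 EW2.
have pub : \int[P m]_w trap L 1 (W m w) <= 1.
  rewrite -[leRHS](Rintegral_const (P m)); apply: le_Rintegral => //.
  - exact: trap_expectation_integrable.
  - exact: integrable_cst.
  - by move=> w _; exact: trap_le1.
move: plb pub; set p := \int[P m]_w trap L 1 _; set D := \int[P m]_w trap a b _.
move=> plb pub.
set nt := normal_trap a b; set n := normal_trap L 1 in nL nL0 nL1 *.
have nt0 : 0 <= nt := normal_trap_ge0 a b.
have nt1 : nt <= 1 := normal_trap_le1 a b.
have -> : nt / n * p = nt + nt * ((p - n) / n) by field; rewrite gt_eqF.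
have : `|(p - n) / n| <= 2 * eta.
  rewrite normrM normfV (gtr0_norm nL0) ler_pdivrMr// ler_norml.
  by apply/andP; split; nra.
rewrite !ler_norml => /andP[]; move: (_ / n) => r r1 r2 /andP[h1 h2].
by apply/andP; split; nra.
Unshelve. all: by end_near. Qed.

End trap_limit.

(** * Moments of the error sums *)

(** Inversion is continuous off 0 only, so the line is split into the open set of nonzero reals and
    a measurable singleton. *)
Lemma measurable_fun_invr {R : realType} : measurable_fun [set: R] (@GRing.inv R).
Proof.
have <- : [set~ (0 : R)] `|` [set 0] = setT by rewrite setUC setUv.
have m0 : measurable [set (0 : R)] by exact: measurable_set1.
apply/measurable_funU => //; first exact: measurableC.
split; last exact: measurable_fun_set1.
apply: open_continuous_measurable_fun.
  by apply: closed_openC; exact: closed_eq.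
by move=> x; rewrite inE/= => /eqP x0; exact: inv_continuous.
Qed.

Section cells.
Context {d} {T : measurableType d} {R : realType} (P : probability T R).
Variables (n : nat) (eta eps : nat -> bool -> T -> R) (s_eta s_eps : R).

Let X (i : 'I_n * bool) w := (eta i.1 i.2 w, eps i.1 i.2 w).

Hypothesis meta : forall a v, measurable_fun setT (eta a v).
Hypothesis meps : forall a v, measurable_fun setT (eps a v).
Hypothesis XI : mutually_independent P X.
Hypothesis XD : identically_distributed P X.
Hypothesis eta_mean : forall a v, (a < n)%N -> ('E_P[eta a v] = 0)%E.
Hypothesis eps_mean : forall a v, (a < n)%N -> ('E_P[eps a v] = 0)%E.
Hypothesis eta_var : forall a v, (a < n)%N ->
  ('E_P[fun w => (eta a v w ^+ 2)%R] = (s_eta ^+ 2)%R%:E)%E.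
Hypothesis eps_var : forall a v, (a < n)%N ->
  ('E_P[fun w => (eps a v w ^+ 2)%R] = (s_eps ^+ 2)%R%:E)%E.

Let mX i : measurable_fun setT (X i).
Proof. by apply: measurable_fun_pair; [exact: meta|exact: meps]. Qed.

(** Since the integrand is nonnegative, a finite expectation already gives integrability. *)
Lemma expectation_sqr_integrable (Y : T -> R) (r : R) : measurable_fun setT Y ->
  ('E_P[fun w => (Y w ^+ 2)%R] = r%:E)%E ->
  L1 P (fun w => Y w ^+ 2) /\ \int[P]_w (Y w ^+ 2) = r.
Proof.
move=> mY; rewrite unlock => E; split; last by rewrite /Rintegral E.
apply/integrableP; split; first by apply/measurable_EFinP; exact: measurable_funX.
under eq_integral => w _ do rewrite /= ger0_norm ?sqr_ge0//.
by rewrite E ltry.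
Qed.

Lemma expectation_Rintegral (Y : T -> R) (r : R) : ('E_P[Y] = r%:E)%E -> \int[P]_w Y w = r.
Proof. by rewrite unlock /Rintegral => ->. Qed.

Let eta2 (a : 'I_n) v := expectation_sqr_integrable (@meta a v) (eta_var v (ltn_ord a)).
Let eps2 (a : 'I_n) v := expectation_sqr_integrable (@meps a v) (eps_var v (ltn_ord a)).
Let eta1 (a : 'I_n) v := expectation_Rintegral (eta_mean v (ltn_ord a)).
Let eps1 (a : 'I_n) v := expectation_Rintegral (eps_mean v (ltn_ord a)).

Let indep_X i j : i != j -> indep P (X i) (X j).
Proof.
move=> ij; apply: (indep_disjoint mX XI (J1 := [set i]%SET) (J2 := [set j]%SET)).
- by move=> k; rewrite !inE => /eqP ->.
- by apply: measurable_cylinders; rewrite inE.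
- by apply: measurable_cylinders; rewrite inE.
Qed.

Lemma indep_eta_eps (a b : 'I_n) : indep P (eta a false) (eps b true).
Proof.
have ab : (a, false) != (b, true) by rewrite xpair_eqE andbF.
exact: (indep_comp measurable_fst measurable_snd (indep_X ab)).
Qed.

Lemma indep_eta_eta (a b : 'I_n) : indep P (eta a false) (eta b true).
Proof.
have ab : (a, false) != (b, true) by rewrite xpair_eqE andbF.
exact: (indep_comp measurable_fst measurable_fst (indep_X ab)).
Qed.

(** Says that [x b] depends on the two folds of cell [b] alone. Quantifying over every [J] that
    contains them serves single cells and unions of cells alike. *)
Definition cell_measurable (x : 'I_n -> T -> R) :=
  forall b (J : {set 'I_n * bool}), (b, false) \in J -> (b, true) \in J ->
  measurable_fun setT (x b : g_sigma_algebraType (cylinders X J) -> R).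

Let cell_measurable_eta v : cell_measurable (fun b => eta b v).
Proof.
move=> b J J0 J1; apply: (measurableT_comp measurable_fst
  (@measurable_cylinders _ _ _ _ X J (b, v) _)).
by case: v.
Qed.

Let cell_measurable_eps v : cell_measurable (fun b => eps b v).
Proof.
move=> b J J0 J1; apply: (measurableT_comp measurable_snd
  (@measurable_cylinders _ _ _ _ X J (b, v) _)).
by case: v.
Qed.

Let cell_measurableM x y : cell_measurable x -> cell_measurable y ->
  cell_measurable (fun b w => x b w * y b w).
Proof. by move=> mx my b J J0 J1; apply: measurable_funM; [exact: mx|exact: my]. Qed.

Let cell_measurableZ (k : 'I_n -> R) x : cell_measurable x ->
  cell_measurable (fun b w => k b * x b w).
Proof. by move=> mx b J J0 J1; apply: measurable_funM => //; exact: mx. Qed.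

Let cell_measurable_measurable x b : cell_measurable x -> measurable_fun setT (x b).
Proof.
move=> mx _ B mB; rewrite setTI.
(* With [J] the full index set, the cylinder sigma-algebra is contained in the ambient one. *)
have := @mx b finset.setT (finset.in_setT _) (finset.in_setT _) measurableT B mB.
rewrite setTI; apply: smallest_sub; last exact: cylinders_measurable.
exact: sigma_algebra_measurable.
Qed.

Lemma cell_indep x a b : cell_measurable x -> a != b -> indep P (x a) (x b).
Proof.
move=> mx ab.
apply: (indep_disjoint mX XI (J1 := [set i | i.1 == a]%SET) (J2 := [set i | i.1 == b]%SET)).
- by move=> i; rewrite !inE => /eqP ->.
- by apply: mx; rewrite inE.
- by apply: mx; rewrite inE.
Qed.

Lemma cell_indep_sum x a : cell_measurable x ->
  indep P (x a) (fun w => \sum_(b | b != a) x b w).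
Proof.
(* The restricted sum becomes a full sum with zero terms, so that measurability for the block of the
   other cells can be checked term by term. *)
move=> mx; under eq_fun do rewrite big_mkcond.
apply: (indep_disjoint mX XI (J1 := [set i | i.1 == a]%SET) (J2 := [set i | i.1 != a]%SET)).
- by move=> i; rewrite !inE negbK.
- by apply: mx; rewrite inE.
- apply: measurable_sum => b; case: (boolP (b != a)) => ba /=; last exact: measurable_cst.
  by apply: mx; rewrite inE.
Qed.

(** Distinct cells are independent and centered, so the cross terms have mean zero. *)
Lemma cell_second_moment x (v : 'I_n -> R) : cell_measurable x ->
  (forall a, \int[P]_w x a w = 0) ->
  (forall a, L1 P (fun w => x a w ^+ 2) /\ \int[P]_w (x a w ^+ 2) = v a) ->
  L1 P (fun w => (\sum_a x a w) ^+ 2) /\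
  \int[P]_w ((\sum_a x a w) ^+ 2) = \sum_a v a.
Proof.
move=> cx Ex Ex2; have mx a : measurable_fun setT (x a) by exact: cell_measurable_measurable.
have ix2 a : L1 P (fun w => x a w ^+ 2) by case: (Ex2 a).
have ixx i j : i != j -> \int[P]_w (x i w * x j w) = 0.
  move=> ij; rewrite indep_expectationM ?Ex ?mul0r//; first exact: cell_indep.
    exact: sqr_integrable_integrable.
  exact: sqr_integrable_integrable.
have [ix ->] := second_moment_sum mx ix2 ixx.
by split=> //; apply: eq_bigr => a _; case: (Ex2 a).
Qed.

Lemma indep_product_moments (Y Z : T -> R) (u v : R) :
  measurable_fun setT Y -> measurable_fun setT Z -> indep P Y Z ->
  L1 P (fun w => Y w ^+ 2) /\ \int[P]_w (Y w ^+ 2) = u ->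
  L1 P (fun w => Z w ^+ 2) /\ \int[P]_w (Z w ^+ 2) = v ->
  L1 P (fun w => (Y w * Z w) ^+ 2) /\ \int[P]_w ((Y w * Z w) ^+ 2) = u * v.
Proof.
move=> mY mZ YZ [iY EY] [iZ EZ].
have [] := indep_integrableM_expectation (measurable_funX 2 mY) (measurable_funX 2 mZ)
  (indep_comp (exprn_measurable 2) (exprn_measurable 2) YZ) iY iZ.
rewrite EY EZ => i E; split; first by under eq_fun do rewrite exprMn.
by under eq_Rintegral do rewrite exprMn.
Qed.

Lemma scaled_moments (k : R) (Y : T -> R) (u : R) :
  L1 P (fun w => Y w ^+ 2) /\ \int[P]_w (Y w ^+ 2) = u ->
  L1 P (fun w => (k * Y w) ^+ 2) /\ \int[P]_w ((k * Y w) ^+ 2) = k ^+ 2 * u.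
Proof.
move=> [iY EY]; split.
  by under eq_fun do rewrite exprMn; exact: integrable_scale.
by under eq_Rintegral do rewrite exprMn; rewrite RintegralZl// EY.
Qed.

Lemma linear_eta_moments (p : nat -> R) v :
  L1 P (fun w => (\sum_(a < n) p a * eta a v w) ^+ 2) /\
  \int[P]_w ((\sum_(a < n) p a * eta a v w) ^+ 2) = (\sum_(a < n) p a ^+ 2) * s_eta ^+ 2.
Proof.
rewrite mulr_suml; apply: (cell_second_moment (x := fun a w => p a * eta a v w)).
- exact: cell_measurableZ.
- move=> a; rewrite RintegralZl ?eta1 ?mulr0//.
  by apply: sqr_integrable_integrable => //; case: (eta2 a v).
- by move=> a; apply: scaled_moments; exact: eta2.
Qed.

Lemma linear_eps_moments (p : nat -> R) v :
  L1 P (fun w => (\sum_(a < n) p a * eps a v w) ^+ 2) /\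
  \int[P]_w ((\sum_(a < n) p a * eps a v w) ^+ 2) = (\sum_(a < n) p a ^+ 2) * s_eps ^+ 2.
Proof.
rewrite mulr_suml; apply: (cell_second_moment (x := fun a w => p a * eps a v w)).
- exact: cell_measurableZ.
- move=> a; rewrite RintegralZl ?eps1 ?mulr0//.
  by apply: sqr_integrable_integrable => //; case: (eps2 a v).
- by move=> a; apply: scaled_moments; exact: eps2.
Qed.

(** The two factors in a cell come from different folds, hence are independent: each product is
    centered, with second moment [s_eta ^+ 2 * s_eta ^+ 2]. *)
Lemma cross_eta_moments :
  L1 P (fun w => (\sum_(a < n) eta a false w * eta a true w) ^+ 2) /\
  \int[P]_w ((\sum_(a < n) eta a false w * eta a true w) ^+ 2) =
    n%:R * (s_eta ^+ 2 * s_eta ^+ 2).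
Proof.
have -> : n%:R * (s_eta ^+ 2 * s_eta ^+ 2) = \sum_(a < n) s_eta ^+ 2 * s_eta ^+ 2.
  by rewrite sumr_const card_ord mulr_natl.
apply: (cell_second_moment (x := fun a w => eta a false w * eta a true w)).
- exact: cell_measurableM.
- move=> a; rewrite indep_expectationM ?eta1 ?mul0r//; first exact: indep_eta_eta.
    by apply: sqr_integrable_integrable => //; case: (eta2 a false).
  by apply: sqr_integrable_integrable => //; case: (eta2 a true).
- move=> a; apply: indep_product_moments => //; first exact: indep_eta_eta.
Qed.

Definition xi (a : 'I_n) w :=
  (s_eta * s_eps * Num.sqrt n%:R)^-1 * (eta a false w * eps a true w).

Hypothesis n0 : (0 < n)%N.
Hypothesis s_eta0 : 0 < s_eta.
Hypothesis s_eps0 : 0 < s_eps.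

Let sqrtn0 : 0 < Num.sqrt n%:R :> R. Proof. by rewrite sqrtr_gt0 ltr0n. Qed.

Lemma xi_measurable a : measurable_fun setT (xi a).
Proof. by apply: measurable_funM => //; exact: measurable_funM. Qed.

(** [eta] and [eps] are taken from opposite folds, so their product is centered even if the
    components of one pair are correlated. *)
Lemma xi_mean a : \int[P]_w xi a w = 0.
Proof.
have i1 : L1 P (eta a false).
  by apply: sqr_integrable_integrable => //; case: (eta2 a false).
have i2 : L1 P (eps a true).
  by apply: sqr_integrable_integrable => //; case: (eps2 a true).
have [i12 E] := indep_integrableM_expectation (@meta a false) (@meps a true)
  (@indep_eta_eps a a) i1 i2.
by rewrite RintegralZl// E eta1 mul0r mulr0.
Qed.

Lemma xi_sqr a : L1 P (fun w => xi a w ^+ 2) /\ \int[P]_w (xi a w ^+ 2) = n%:R^-1.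
Proof.
have -> : n%:R^-1 = (s_eta * s_eps * Num.sqrt n%:R)^-1 ^+ 2 * (s_eta ^+ 2 * s_eps ^+ 2).
  rewrite exprVn !exprMn sqr_sqrtr ?ler0n// ; field.
  by rewrite pnatr_eq0 -lt0n n0 !gt_eqF.
apply: scaled_moments; apply: indep_product_moments => //; first exact: indep_eta_eps.
Qed.

Let cell_measurable_xi : cell_measurable xi.
Proof. by apply: cell_measurableZ; exact: cell_measurableM. Qed.

Lemma xi_indep_sum a : indep P (xi a) (fun w => \sum_(b | b != a) xi b w).
Proof. exact: cell_indep_sum. Qed.

Lemma xi_sum_moments : L1 P (fun w => (\sum_a xi a w) ^+ 2) /\
  \int[P]_w ((\sum_a xi a w) ^+ 2) = 1.
Proof.
have <- : \sum_(a < n) n%:R^-1 = 1 :> R.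
  by rewrite sumr_const card_ord -[_ *+ _]mulr_natl divff// pnatr_eq0 -lt0n.
by apply: cell_second_moment => // a; [exact: xi_mean|exact: xi_sqr].
Qed.

(** The normalized product equals [sqrt n] times [xi], so truncation at [del] turns into truncation
    at [del * sqrt n], and the factor [n] is absorbed by the square. Identical distribution replaces
    cell [a] by cell 0. *)
Lemma xi_truncated (del : R) (a : 'I_n) : 0 < del ->
  n%:R * \int[P]_w (if del <= `|xi a w| then xi a w ^+ 2 else 0) =
  fine ('E_P[fun w => (
        let z := eta 0%N false w * eps 0%N true w / (s_eta * s_eps) in
        if del * Num.sqrt n%:R <= `|z| then z ^+ 2 else 0)%R])%E.
Proof.
move=> del0; pose k := (s_eta * s_eps * Num.sqrt n%:R)^-1.
pose F (z : R * R) := if del <= `|k * (z.1 * z.2)| then (k * (z.1 * z.2)) ^+ 2 else 0.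
have mz : measurable_fun setT (fun z : R * R => k * (z.1 * z.2)).
  by apply: measurable_funM => //; exact: measurable_funM.
have mF : measurable_fun setT F.
  apply: measurable_fun_ifT => //; last exact: measurable_funX.
  by apply: measurable_fun_ler => //; exact: measurableT_comp.
have F0 z : 0 <= F z by rewrite /F; case: ifP => // _; exact: sqr_ge0.
pose o : 'I_n := Ordinal n0.
have marg (i j : 'I_n * bool) (B : set R) : measurable B ->
    P (eta i.1 i.2 @^-1` B) = P (eta j.1 j.2 @^-1` B) /\
    P (eps i.1 i.2 @^-1` B) = P (eps j.1 j.2 @^-1` B).
  move=> mB; split.
    have := @XD i j (fst @^-1` B); apply.
    by rewrite -[X in measurable X]setTI; exact: measurable_fst.
  have := @XD i j (snd @^-1` B); apply.
  by rewrite -[X in measurable X]setTI; exact: measurable_snd.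
have E : (\int[P]_w (F (eta a false w, eps a true w))%:E =
    \int[P]_w (F (eta 0%N false w, eps 0%N true w))%:E)%E.
  apply: indep_eq_integral => //.
  - exact: indep_eta_eps.
  - exact: (@indep_eta_eps o o).
  - by move=> B mB; case: (@marg (a, false) (o, false) B mB).
  - by move=> B mB; case: (@marg (a, true) (o, true) B mB).
have -> : \int[P]_w (if del <= `|xi a w| then xi a w ^+ 2 else 0) =
    \int[P]_w F (eta 0%N false w, eps 0%N true w).
  by rewrite /Rintegral -E.
have iF : L1 P (fun w => F (eta 0%N false w, eps 0%N true w)).
  apply: (integrable_dom _ (xi_sqr o).1).
    by apply: (measurableT_comp mF); exact: measurable_fun_pair.
  move=> w; rewrite ger0_norm ?F0// /F /xi /=.
  by case: ifP => // _; exact: sqr_ge0.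
rewrite -RintegralZl// unlock /Rintegral; congr fine.
apply: eq_integral => w _; congr EFin; rewrite /F/=.
have -> : eta 0%N false w * eps 0%N true w / (s_eta * s_eps) =
    Num.sqrt n%:R * (k * (eta 0%N false w * eps 0%N true w)).
  by rewrite /k; field; rewrite !gt_eqF.
move: (k * _) => y; rewrite [`|_ * y|]normrM gtr0_norm// [del * _]mulrC ler_pM2l//.
case: ifP => _; last by rewrite mulr0.
by rewrite [RHS]exprMn sqr_sqrtr.
Qed.

End cells.

(** * Coverage and consistency *)

Section trap_probability.
Context {d} {T : measurableType d} {R : realType} (P : probability T R).
Variable W : T -> R.
Hypothesis mW : measurable_fun setT W.

Lemma measurable_norm_le (a : R) : measurable [set w | `|W w| <= a].
Proof.
rewrite -[X in measurable X]setTI; apply: measurable_fun_le => //.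
exact: measurableT_comp.
Qed.

Lemma probability_le_trap (a b : R) : 0 < b ->
  fine (P [set w | `|W w| <= a]) <= \int[P]_w trap a b (W w).
Proof.
move=> b0; have mA := measurable_norm_le a.
rewrite -Rintegral_indic//; apply: le_Rintegral => //.
- exact: integrable_indicator.
- exact: trap_expectation_integrable.
move=> w _; rewrite indicE; case: (boolP (w \in _)) => [|_]; last exact: trap_ge0.
by rewrite inE/= => Wa; rewrite trap_in.
Qed.

Lemma trap_le_probability (a b : R) : 0 < b ->
  \int[P]_w trap a b (W w) <= fine (P [set w | `|W w| <= a + b]).
Proof.
move=> b0; have mA := measurable_norm_le (a + b).
rewrite -Rintegral_indic//; apply: le_Rintegral => //.
- exact: trap_expectation_integrable.
- exact: integrable_indicator.
move=> w _; rewrite indicE; have [Wab|Wab] := leP `|W w| (a + b).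
  by rewrite mem_set// trap_le1.
by rewrite trap_out// ltW.
Qed.

End trap_probability.

(** Up to [B m], the event [C m] lies between [|W| <= q - b] and [|W| <= q + b]. Trapezoids with
    slopes of width [b] bound these probabilities, and their limits lie between
    [2 * Phi (q - 2 * b) - 1] and [2 * Phi (q + 2 * b) - 1]. *)
Lemma sandwich_cvg {d} {T : nat -> measurableType d} {R : realType}
  (P : forall m, probability (T m) R) (W : forall m, T m -> R)
  (C : forall m, set (T m)) (q : R) :
  (forall m, measurable_fun setT (W m)) -> (forall m, measurable (C m)) ->
  (forall a b : R, 0 < b ->
    (fun m => \int[P m]_w trap a b (W m w)) @ \oo --> normal_trap a b) ->
  0 < q ->
  (forall b : R, 0 < b -> exists B : forall m, set (T m),
    [/\ forall m, measurable (B m), (fun m => fine (P m (B m))) @ \oo --> (0 : R) &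
    \forall m \near \oo, (C m `<=` [set w | `|W m w| <= q + b] `|` B m) /\
      ([set w | `|W m w| <= q - b] `<=` C m `|` B m)]) ->
  (fun m => fine (P m (C m))) @ \oo --> 2 * Phi q - 1.
Proof.
move=> mW mC Wcvg q0 CW; apply/cvgrPdist_le => e e0.
pose c : R := normal_peak 1.
have c0 : 0 <= c := normal_peak_ge0 1.
(* The first bound keeps [q - 2 * b] nonnegative. The second makes the Lipschitz loss [4 * c * b] at
   most [e / 2]; the other half of [e] is shared by the trapezoid limit and [B m]. *)
pose b := Num.min (q / 4) (e / (8 * (c + 1))).
have b0 : 0 < b by rewrite lt_min !divr_gt0// mulr_gt0//; lra.
have bq : b <= q / 4 by rewrite ge_min lexx.
have cb : c * b <= e / 8.
  have : b <= e / (8 * (c + 1)) by rewrite ge_min lexx orbT.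
  rewrite ler_pdivlMr ?mulr_gt0//; last lra.
  by nra.
have [B [mB PB CB]] := CW b b0.
have e4 : 0 < e / 4 by rewrite divr_gt0.
have /cvgrPdist_le/(_ _ e4) n1 := Wcvg (q + b) b b0.
have /cvgrPdist_le/(_ _ e4) n2 := Wcvg (q - 2 * b) b b0.
move/cvgrPdist_le/(_ _ e4) : PB => n3.
have t1 : normal_trap (q + b) b <= 2 * Phi (q + 2 * b) - 1.
  have -> : q + 2 * b = q + b + b by ring.
  by apply: normal_trap_ub => //; lra.
have t2 : 2 * Phi (q - 2 * b) - 1 <= normal_trap (q - 2 * b) b.
  by apply: normal_trap_lb => //; lra.
have l1 : Phi (q + 2 * b) <= Phi q + c * (q + 2 * b - q) by apply: Phi_lipschitz; lra.
have l2 : Phi q <= Phi (q - 2 * b) + c * (q - (q - 2 * b)) by apply: Phi_lipschitz; lra.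
near=> m.
have h1 : `|normal_trap (q + b) b - \int[P m]_w trap (q + b) b (W m w)| <= e / 4 by near: m.
have h2 : `|normal_trap (q - 2 * b) b - \int[P m]_w trap (q - 2 * b) b (W m w)| <= e / 4.
  by near: m.
have h3 : `|0 - fine (P m (B m))| <= e / 4 by near: m.
have [C1 C2] : (C m `<=` [set w | `|W m w| <= q + b] `|` B m) /\
      ([set w | `|W m w| <= q - b] `<=` C m `|` B m) by near: m.
have mle a : measurable [set w | `|W m w| <= a] by exact: measurable_norm_le.
have u1 := fine_probability_le (P m) (mC m) (measurableU _ _ (mle (q + b)) (mB m)) C1.
have u2 := fine_probabilityU (P m) (mle (q + b)) (mB m).
have u3 := probability_le_trap (P m) (mW m) (q + b) b0.
have v1 := fine_probability_le (P m) (mle (q - b)) (measurableU _ _ (mC m) (mB m)) C2.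
have v2 := fine_probabilityU (P m) (mC m) (mB m).
have v3 := trap_le_probability (P m) (mW m) (q - 2 * b) b0.
rewrite (_ : q - 2 * b + b = q - b) in v3; last by ring.
move: h1 h2 h3; rewrite !ler_norml => /andP[h1 h1'] /andP[h2 h2'] /andP[h3 h3'].
by apply/andP; split; lra.
Unshelve. all: by end_near. Qed.

Lemma cvg_to0_le {R : realType} (u : nat -> R) : (forall m, 0 <= u m) ->
  (forall e : R, 0 < e -> \forall m \near \oo, u m <= e) -> u @ \oo --> (0 : R).
Proof.
move=> u0 ue; apply/cvgrPdist_le => e e0; apply: filterS (ue e e0) => m.
by rewrite sub0r normrN ger0_norm.
Qed.

(** * Algebra of the estimation error and of the studentized interval *)

Section error_bound.
Context {R : realType}.
Variables (beta S A q hx he sx se rn t Z : R).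
Hypothesis rn0 : 0 < rn.
Hypothesis sx0 : 0 < sx.
Hypothesis se0 : 0 < se.
Hypothesis t0 : 0 < t.
Hypothesis SE : S = rn * sx ^+ 2 * t.
Hypothesis AE : A = sx * se * rn * Z.

(** To be read with [S] the denominator, [A] the error part of the numerator, [rn] the root of the
    number of cells, [t = mu + noise] and [Z = W + rem]. *)
Lemma estimation_error : S^-1 * (beta * S + A) - beta = se / (sx * t) * Z.
Proof. by rewrite SE AE; field; rewrite !gt_eqF. Qed.

(** Error and half-width share the positive factor [se / (sx * t)]; once it cancels, the random
    denominator is gone. *)
Lemma coverage_studentized :
  (`|beta - S^-1 * (beta * S + A)| <= `|q * (S / rn)^-1 * hx * he|) =
  (`|Z| <= `|q * (hx / sx * (he / se))|).
Proof.
rewrite distrC estimation_error.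
have -> : q * (S / rn)^-1 * hx * he = se / (sx * t) * (q * (hx / sx * (he / se))).
  by rewrite SE; field; rewrite !gt_eqF.
have k0 : 0 < se / (sx * t) by rewrite divr_gt0// mulr_gt0.
by rewrite !(normrM (se / (sx * t))) ler_pM2l// normr_gt0 gt_eqF.
Qed.

End error_bound.

(** * Consistency and coverage of the jackknife estimator *)

Section jackknife.
Context {R : realType} {d : measure_display} {T : nat -> measurableType d}.
Variables (P : forall m, probability (T m) R) (K : nat -> nat) (beta : R).
Variables (pi : nat -> nat -> R) (eta eps : forall m, nat -> bool -> T m -> R).
Variables (sig_eta sig_eps : nat -> R) (c : R).
Arguments eta : clear implicits.
Arguments eps : clear implicits.

Hypothesis K_cvg : (fun m => (K m)%:R : R) @ \oo --> +oo.
Hypothesis m_err : forall m a v,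
  measurable_fun setT (eta m a v) /\ measurable_fun setT (eps m a v).
Hypothesis err_indep : forall m, mutually_independent (P m)
  (fun i : 'I_(K m) * bool => fun w => (eta m i.1 i.2 w, eps m i.1 i.2 w)).
Hypothesis err_ident : forall m, identically_distributed (P m)
  (fun i : 'I_(K m) * bool => fun w => (eta m i.1 i.2 w, eps m i.1 i.2 w)).
Hypothesis err_mean : forall m a v, (a < K m)%N ->
  ('E_(P m)[eta m a v] = 0)%E /\ ('E_(P m)[eps m a v] = 0)%E.
Hypothesis sig_gt0 : forall m, 0 < sig_eta m /\ 0 < sig_eps m.
Hypothesis err_var : forall m a v, (a < K m)%N ->
  ('E_(P m)[fun w => (eta m a v w ^+ 2)%R] = (sig_eta m ^+ 2)%R%:E)%E /\
  ('E_(P m)[fun w => (eps m a v w ^+ 2)%R] = (sig_eps m ^+ 2)%R%:E)%E.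

Let s_eta0 m : 0 < sig_eta m. Proof. by case: (sig_gt0 m). Qed.
Let s_eps0 m : 0 < sig_eps m. Proof. by case: (sig_gt0 m). Qed.
Let meta m a v : measurable_fun setT (eta m a v). Proof. by case: (m_err m a v). Qed.
Let meps m a v : measurable_fun setT (eps m a v). Proof. by case: (m_err m a v). Qed.
Let eta_mean m a v aK := (@err_mean m a v aK).1.
Let eps_mean m a v aK := (@err_mean m a v aK).2.
Let eta_var m a v aK := (@err_var m a v aK).1.
Let eps_var m a v aK := (@err_var m a v aK).2.

Let n m : R := (K m)%:R.
Let rn m : R := Num.sqrt (n m).
Let S2 m : R := \sum_(a < K m) pi m a ^+ 2.
Let W m w := \sum_(a < K m) xi (eta m) (eps m) (sig_eta m) (sig_eps m) a w.
(** [rem] is the linear part of the normalized numerator, with second moment [ratio]. In the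
    denominator divided by [rn * sig_eta ^+ 2], [mu] is the signal and [noise] the random part. *)
Let rem m w := (sig_eta m * sig_eps m * rn m)^-1 * \sum_(a < K m) pi m a * eps m a true w.
Let mu m := S2 m / (rn m * sig_eta m ^+ 2).
Let ratio m := S2 m / (n m * sig_eta m ^+ 2).
Let noise m w := (rn m * sig_eta m ^+ 2)^-1 *
  (\sum_(a < K m) pi m a * eta m a false w + \sum_(a < K m) pi m a * eta m a true w +
   \sum_(a < K m) eta m a false w * eta m a true w).
Arguments W : clear implicits.
Arguments rem : clear implicits.
Arguments noise : clear implicits.

Let mW m : measurable_fun setT (W m).
Proof. by apply: measurable_sum => a; exact: xi_measurable. Qed.

Let mrem m : measurable_fun setT (rem m).
Proof.
apply: measurable_funM => //; apply: measurable_sum => a.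
by apply: measurable_funM.
Qed.

Let mnoise m : measurable_fun setT (noise m).
Proof.
apply: measurable_funM => //; apply: measurable_funD; first apply: measurable_funD;
  by apply: measurable_sum => a; exact: measurable_funM.
Qed.

Let near_K : \forall m \near \oo, (0 < K m)%N.
Proof.
move/cvgryPgt : K_cvg => /(_ 0); apply: filterS => m.
by rewrite ltr0n.
Qed.

Let rn0 m : (0 < K m)%N -> 0 < rn m.
Proof. by move=> K0; rewrite sqrtr_gt0 ltr0n. Qed.

Let rn_sqr m : rn m ^+ 2 = n m. Proof. by rewrite sqr_sqrtr// ler0n. Qed.

Let W_moments m : (0 < K m)%N ->
  L1 (P m) (fun w => W m w ^+ 2) /\ \int[P m]_w (W m w ^+ 2) = 1.
Proof.
move=> K0; exact: (xi_sum_moments (@meta m) (@meps m) (@err_indep m)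
  (@eta_mean m) (@eta_var m) (@eps_var m) K0 (s_eta0 m) (s_eps0 m)).
Qed.

Let rem_moments m : (0 < K m)%N ->
  L1 (P m) (fun w => rem m w ^+ 2) /\ \int[P m]_w (rem m w ^+ 2) = ratio m.
Proof.
move=> K0; have -> : ratio m = (sig_eta m * sig_eps m * rn m)^-1 ^+ 2 * (S2 m * sig_eps m ^+ 2).
  rewrite /ratio -rn_sqr; field.
  by rewrite !gt_eqF ?rn0.
apply: scaled_moments.
exact: (linear_eps_moments (@meta m) (@meps m) (@err_indep m) (@eps_mean m) (@eps_var m)).
Qed.

Lemma sqrD3_le (x y z : R) : (x + y + z) ^+ 2 <= 3 * (x ^+ 2 + y ^+ 2 + z ^+ 2).
Proof. by have := sqr_ge0 (x - y); have := sqr_ge0 (y - z); have := sqr_ge0 (x - z); nra. Qed.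

(** Bounding the square of a sum of three terms by three times the sum of squares avoids cross
    moments. Each linear term contributes [ratio], the product term contributes 1. *)
Let noise_moments m : (0 < K m)%N ->
  L1 (P m) (fun w => noise m w ^+ 2) /\
  \int[P m]_w (noise m w ^+ 2) <= 3 * (2 * ratio m + 1).
Proof.
move=> K0; pose k := (rn m * sig_eta m ^+ 2)^-1.
have [i0 E0] := scaled_moments k (linear_eta_moments (@meta m) (@meps m)
  (@err_indep m) (@eta_mean m) (@eta_var m) (pi m) false).
have [i1 E1] := scaled_moments k (linear_eta_moments (@meta m) (@meps m)
  (@err_indep m) (@eta_mean m) (@eta_var m) (pi m) true).
have [i2 E2] := scaled_moments k (cross_eta_moments (@meta m) (@meps m)
  (@err_indep m) (@eta_mean m) (@eta_var m)).
have i01 := integrable_add (integrable_add i0 i1) i2.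
have noise_le w : noise m w ^+ 2 <= 3 *
  ((k * (\sum_(a < K m) pi m a * eta m a false w)) ^+ 2 +
   (k * (\sum_(a < K m) pi m a * eta m a true w)) ^+ 2 +
   (k * (\sum_(a < K m) eta m a false w * eta m a true w)) ^+ 2).
  have -> : noise m w = k * (\sum_(a < K m) pi m a * eta m a false w) +
      k * (\sum_(a < K m) pi m a * eta m a true w) +
      k * (\sum_(a < K m) eta m a false w * eta m a true w).
    by rewrite /noise !mulrDr.
  exact: sqrD3_le.
have inoise : L1 (P m) (fun w => noise m w ^+ 2).
  apply: (integrable_dom _ (integrable_scale 3 i01)); first exact: measurable_funX.
  by move=> w; rewrite ger0_norm ?sqr_ge0.
split=> //.
apply: (le_trans (le_Rintegral measurableT inoise (integrable_scale 3 i01)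
  (fun w _ => noise_le w))).
rewrite RintegralZl// RintegralD//; last exact: integrable_add.
rewrite RintegralD// E0 E1 E2 le_eqVlt; apply/orP; left; apply/eqP.
rewrite /k /ratio -/(S2 m) -rn_sqr -/(n m) -rn_sqr; field.
by rewrite !gt_eqF ?rn0.
Qed.

Let SS_decomposition m w : (0 < K m)%N ->
  SS K pi eta w = rn m * sig_eta m ^+ 2 * (mu m + noise m w).
Proof.
move=> K0; rewrite /mu /noise mulrDr mulrCA mulfV ?mulVKf ?mulf_neq0 ?expf_neq0//;
  rewrite ?gt_eqF ?rn0// mulr1.
rewrite /S2 -!big_split/=; apply: eq_bigr => a _; rewrite /Sbar; ring.
Qed.

Let numerator m w := \sum_(a < K m) Sbar pi eta a false w * eps m a true w.
Arguments numerator : clear implicits.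

Let numerator_decomposition m w : (0 < K m)%N ->
  numerator m w = sig_eta m * sig_eps m * rn m * (W m w + rem m w).
Proof.
move=> K0; rewrite mulrDr /rem mulVKf; last by rewrite !mulf_neq0// gt_eqF// rn0.
rewrite /W mulr_sumr -big_split/=; apply: eq_bigr => a _.
rewrite /xi mulVKf; last by rewrite !mulf_neq0// gt_eqF// rn0.
by rewrite /Sbar; ring.
Qed.

(** Keeping [beta * SS] inside the bracket makes the identity valid also where [SS] vanishes. *)
Let betahatE m w : betahat K beta pi eta eps w =
  (SS K pi eta w)^-1 * (beta * SS K pi eta w + numerator m w).
Proof.
rewrite /betahat; congr (_ * _).
rewrite /SS mulr_sumr -big_split/=; apply: eq_bigr => a _; rewrite /Ybar; ring.
Qed.


Hypothesis ratio_cvg :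
  (fun m => (\sum_(a < K m) pi m a ^+ 2) / ((K m)%:R * sig_eta m ^+ 2)) @ \oo --> (0 : R).
Hypothesis c_ge0 : 0 <= c.
Hypothesis sig_cvg : (fun m => sig_eps m / sig_eta m) @ \oo --> c.
Hypothesis mu_cvg : (fun m => (\sum_(a < K m) pi m a ^+ 2) /
  (Num.sqrt (K m)%:R * sig_eta m ^+ 2)) @ \oo --> +oo.
Hypothesis lindeberg : forall e : R, 0 < e ->
  (fun m => ('E_(P m)[fun w => (
     let z := eta m 0%N false w * eps m 0%N true w / (sig_eta m * sig_eps m) in
     if e * Num.sqrt (K m)%:R <= `|z| then z ^+ 2 else 0)%R])%E) @ \oo --> 0%E.

Let W_stein (f f' : R -> R) : (forall x : R, is_derive x 1 f (f' x)) ->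
  continuous f' -> (exists M : R, forall x, `|f x| <= M) ->
  (exists M : R, forall x, `|f' x| <= M) ->
  (forall e : R, 0 < e ->
    exists2 del, 0 < del & forall x y, `|x - y| < del -> `|f' x - f' y| <= e) ->
  (fun m => \int[P m]_w (W m w * f (W m w)) - \int[P m]_w f' (W m w))
    @ \oo --> (0 : R).
Proof.
move=> df cf' [M' fM] [M f'M] uc; apply/cvgrPdist_le => e e0.
have M0 : 0 <= M by exact: le_trans (f'M 0).
(* Each of the three terms of [stein_bound] is to be at most [e / 3]: hence modulus [e / 6],
   Lindeberg term at most [e / (6 * (M + 1))], and at least [6 * (M + 1) / (e * del ^+ 2)] cells.
   Using [M + 1] avoids division by zero. *)
have [|del del0 dP] := uc (e / 6); first by rewrite divr_gt0.
pose lin m := fine ('E_(P m)[fun w => (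
     let z := eta m 0%N false w * eps m 0%N true w / (sig_eta m * sig_eps m) in
     if del * Num.sqrt (K m)%:R <= `|z| then z ^+ 2 else 0)%R])%E.
have lin0 : lin @ \oo --> (0 : R) by exact: fine_cvg (lindeberg del0).
have eM : 0 < e / (6 * (M + 1)) by rewrite divr_gt0// mulr_gt0//; lra.
move/cvgrPdist_le : lin0 => /(_ _ eM) near_lin.
move/cvgryPge : K_cvg => /(_ (6 * (M + 1) / (e * del ^+ 2))) near_n.
near=> m.
have K0 : (0 < K m)%N by near: m.
have nge : 6 * (M + 1) / (e * del ^+ 2) <= n m by near: m.
have n0 : 0 < n m by rewrite ltr0n.
have lin_le : `|0 - lin m| <= e / (6 * (M + 1)) by near: m.
have ellE (a : 'I_(K m)) : \int[P m]_w (if del <=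
    `|xi (eta m) (eps m) (sig_eta m) (sig_eps m) a w| then
     xi (eta m) (eps m) (sig_eta m) (sig_eps m) a w ^+ 2 else 0) = (n m)^-1 * lin m.
  have := xi_truncated (@meta m) (@meps m) (@err_indep m) (@err_ident m)
    (@eta_var m) (@eps_var m) K0 (s_eta0 m) (s_eps0 m) a del0.
  by rewrite -/(lin m) => <-; rewrite mulKf// gt_eqF.
pose x := xi (n := K m) (eta m) (eps m) (sig_eta m) (sig_eps m).
have mx a : measurable_fun setT (x a) by apply: xi_measurable.
have ix a : indep (P m) (x a) (fun w => \sum_(b | b != a) x b w).
  by apply: (xi_indep_sum _ _ (@meta m) (@meps m) (@err_indep m)).
have Ex a : \int[P m]_w x a w = 0.
  by apply: (xi_mean (@meta m) (@meps m) (@err_indep m) (@eta_mean m) (@eta_var m) (@eps_var m)).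
have x2 a := xi_sqr (@meta m) (@meps m) (@err_indep m) (@eta_var m) (@eps_var m) K0
  (s_eta0 m) (s_eps0 m) a.
have := stein_bound df cf' fM f'M del0 dP K0 mx ix (fun a => (x2 a).1) Ex
  (fun a => (x2 a).2) ellE.
rewrite -/(n m) mulVKf ?gt_eqF// sub0r normrN => /le_trans; apply.
move: lin_le; rewrite sub0r normrN => /(le_trans (ler_norm _)).
rewrite ler_pdivlMr; last by rewrite mulr_gt0//; lra.
move=> lin_le.
have h : 2 * M / (n m * del ^+ 2) <= e / 3.
  rewrite ler_pdivrMr ?mulr_gt0 ?exprn_gt0//.
  move: nge; rewrite ler_pdivrMr ?mulr_gt0 ?exprn_gt0//.
  by lra.
have h' : 2 * M * lin m <= e / 3.
  have [l0|l0] := leP 0 (lin m); first by nra.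
  by apply: (@le_trans _ _ 0); [nra|rewrite divr_ge0// ltW].
by lra.
Unshelve. all: by end_near. Qed.

Let W_trap_cvg (a b : R) : 0 < b ->
  (fun m => \int[P m]_w trap a b (W m w)) @ \oo --> normal_trap a b.
Proof.
apply: trap_expectation_cvg => //.
by apply: filterS near_K => m; exact: W_moments.
Qed.

Let near_mu (M : R) : \forall m \near \oo, M <= mu m.
Proof. by move/cvgryPge : mu_cvg => /(_ M). Qed.

Let near_ratio (e : R) : 0 < e -> \forall m \near \oo, ratio m <= e.
Proof.
move=> e0; move/cvgrPdist_le : ratio_cvg => /(_ e e0); apply: filterS => m.
by rewrite sub0r normrN => /(le_trans (ler_norm _)).
Qed.

Let measurable_norm_ge (m : nat) (Y : T m -> R) (a : R) : measurable_fun setT Y ->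
  measurable [set w | a <= `|Y w|].
Proof.
move=> mY; rewrite -[X in measurable X]setTI; apply: measurable_fun_le => //.
exact: measurableT_comp.
Qed.

(** Chebyshev at level [mu / 2]: the second moment is at most [3 * (2 + 1) = 9], and
    [36 / mu ^+ 2 <= 36 / mu] because [1 <= mu]. *)
Let noise_prob m : (0 < K m)%N -> ratio m <= 1 -> 1 <= mu m ->
  fine (P m [set w | mu m / 2 <= `|noise m w|]) <= 36 / mu m.
Proof.
move=> K0 r1 mu1; have mu0 : 0 < mu m / 2 by lra.
have [iN EN] := noise_moments K0.
apply: (le_trans (chebyshev_sqr mu0 (@mnoise m) iN)).
rewrite ler_pdivrMr ?exprn_gt0//.
have -> : 36 / mu m * (mu m / 2) ^+ 2 = 9 * mu m by field; lra.
by apply: (le_trans EN); lra.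
Qed.

Let noise_cvg : (fun m => fine (P m [set w | mu m / 2 <= `|noise m w|])) @ \oo --> (0 : R).
Proof.
apply: cvg_to0_le => [m|e e0]; first exact: fine_ge0.
near=> m; have K0 : (0 < K m)%N by near: m.
have r1 : ratio m <= 1 by near: m; exact: near_ratio.
have mu1 : 1 <= mu m by near: m; exact: near_mu.
have mue : 36 / e <= mu m by near: m; exact: near_mu.
rewrite (le_trans (noise_prob K0 r1 mu1))//.
by move: mue; rewrite !ler_pdivrMr//; [rewrite mulrC|lra].
Unshelve. all: by end_near. Qed.

Let rem_cvg (b : R) : 0 < b ->
  (fun m => fine (P m [set w | b <= `|rem m w|])) @ \oo --> (0 : R).
Proof.
move=> b0; apply: cvg_to0_le => [m|e e0]; first exact: fine_ge0.
near=> m; have K0 : (0 < K m)%N by near: m.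
have re : ratio m <= e * b ^+ 2.
  by near: m; apply: near_ratio; rewrite mulr_gt0 ?exprn_gt0.
have [iR ER] := rem_moments K0.
rewrite (le_trans (chebyshev_sqr b0 (@mrem m) iR))//.
by rewrite ER ler_pdivrMr ?exprn_gt0.
Unshelve. all: by end_near. Qed.

(** [W] has second moment 1 and [rem] at most 1, so that of the sum is at most [2 * (1 + 1) = 4]. *)
Let Wrem_prob m (t : R) : (0 < K m)%N -> ratio m <= 1 -> 0 < t ->
  fine (P m [set w | t <= `|W m w + rem m w|]) <= 4 / t ^+ 2.
Proof.
move=> K0 r1 t0.
have [iR ER] := rem_moments K0; have [iW EW] := W_moments K0.
have mZ : measurable_fun setT (fun w => W m w + rem m w) by exact: measurable_funD.
have iRW := integrable_scale 2 (integrable_add iW iR).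
have Z_le w : (W m w + rem m w) ^+ 2 <= 2 * (W m w ^+ 2 + rem m w ^+ 2).
  by have := sqr_ge0 (W m w - rem m w); nra.
have iZ : L1 (P m) (fun w => (W m w + rem m w) ^+ 2).
  apply: (integrable_dom _ iRW); first exact: measurable_funX.
  by move=> w; rewrite ger0_norm ?sqr_ge0.
apply: (le_trans (chebyshev_sqr t0 mZ iZ)).
rewrite ler_pM2r ?invr_gt0 ?exprn_gt0//.
apply: (le_trans (le_Rintegral measurableT iZ iRW (fun w _ => Z_le w))).
rewrite RintegralZl//; last exact: integrable_add.
by rewrite RintegralD// ER EW; lra.
Qed.

Let mSS m : measurable_fun setT (fun w => SS K pi eta (m := m) w).
Proof.
apply: measurable_sum => a.
by apply: measurable_funM; apply: measurable_funD.
Qed.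

Let mbetahat m : measurable_fun setT (fun w => betahat K beta pi eta eps (m := m) w).
Proof.
apply: measurable_funM.
  by apply: (measurableT_comp measurable_fun_invr); exact: mSS.
apply: measurable_sum => a; apply: measurable_funM; first exact: measurable_funD.
by apply: measurable_funD => //; apply: measurable_funM => //; exact: measurable_funD.
Qed.

Let near_sig : \forall m \near \oo, sig_eps m / sig_eta m <= c + 1.
Proof.
move/cvgrPdist_le : sig_cvg => /(_ 1 ltr01); apply: filterS => m.
by rewrite distrC => /(le_trans (ler_norm _)); lra.
Qed.

(** Unless [|noise|] reaches [mu / 2], the normalized denominator exceeds [mu / 2], so the error is
    at most [k / (mu / 2)] times [|W + rem|]. As [mu] diverges, both exceptional probabilities
    vanish. *)
Lemma betahat_consistent : cvg_in_prob P (betahat K beta pi eta eps) beta.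
Proof.
move=> e e0; apply: cvg_to0_le => [m|e' e'0]; first exact: fine_ge0.
pose k := c + 1; have k0 : 0 < k by rewrite ltr_wpDl.
(* With [t] as below, the two probabilities are at most [36 / mu] and [4 / t ^+ 2 = 16 * k ^+ 2 / (e
   ^+ 2 * mu ^+ 2)], hence together at most [D / mu] once [1 <= mu]. *)
pose D := 36 + 16 * k ^+ 2 / e ^+ 2.
near=> m.
have K0 : (0 < K m)%N by near: m.
have r1 : ratio m <= 1 by near: m; exact: near_ratio.
have mu1 : 1 <= mu m by near: m; exact: near_mu.
have muD : D / e' <= mu m by near: m; exact: near_mu.
have sk : sig_eps m / sig_eta m <= k by near: m.
(* This level solves [k / (mu / 2) * t = e]. *)
pose t := mu m * e / (2 * k).
have mu0 : 0 < mu m := lt_le_trans ltr01 mu1.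
have t0 : 0 < t by exact: divr_gt0 (mulr_gt0 mu0 e0) (mulr_gt0 (ltr0n _ 2) k0).
have mZ : measurable_fun setT (fun w => W m w + rem m w) by exact: measurable_funD.
have mA : measurable [set w : T m | e < `|betahat K beta pi eta eps w - beta|].
  rewrite -[X in measurable X]setTI.
  apply: (measurable_fun_ltr (D := setT) _ _ measurableT (Y := [set true])) => //.
  by apply: measurableT_comp => //; apply: measurable_funB => //; exact: mbetahat.
have mN := measurable_norm_ge (mu m / 2) (@mnoise m).
have mT := measurable_norm_ge t mZ.
have sub : [set w : T m | e < `|betahat K beta pi eta eps w - beta|] `<=`
    [set w | mu m / 2 <= `|noise m w|] `|` [set w | t <= `|W m w + rem m w|].
  move=> w /= ew; apply: contrapT => /not_orP[/negP]; rewrite -ltNge => N.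
  move=> /negP; rewrite -ltNge => Z.
  have tt : mu m / 2 < mu m + noise m w by move: N; rewrite ltr_norml => /andP[]; lra.
  have tt0 : 0 < mu m + noise m w by lra.
  move: ew; rewrite betahatE (estimation_error beta (rn0 K0) (s_eta0 m) tt0
    (SS_decomposition w K0) (numerator_decomposition w K0)).
  apply/negP; rewrite -leNgt normrM invfM mulrA gtr0_norm; last first.
    by rewrite !mulr_gt0 ?invr_gt0.
  apply: (@le_trans _ _ (k / (mu m / 2) * t)).
    apply: ler_pM => //; last exact: ltW.
      by rewrite !mulr_ge0 ?invr_ge0// ltW.
    apply: ler_pM => //; rewrite ?invr_ge0 ?(ltW tt0)//.
      by rewrite divr_ge0// ltW.
    by rewrite lef_pV2 ?posrE ?(ltW tt)//; lra.
  have k_neq0 : k != 0 by rewrite gt_eqF.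
  have mu_neq0 : mu m != 0 by rewrite gt_eqF//; lra.
  by rewrite /t le_eqVlt; apply/orP; left; apply/eqP; field; rewrite k_neq0 mu_neq0.
apply: (le_trans (fine_probability_le (P m) mA (measurableU _ _ mN mT) sub)).
apply: (le_trans (fine_probabilityU (P m) mN mT)).
apply: (le_trans (lerD (noise_prob K0 r1 mu1) (Wrem_prob K0 r1 t0))).
apply: (@le_trans _ _ (D / mu m)).
  rewrite [leRHS](mulrDl 36) lerD2l (_ : 4 / t ^+ 2 = 16 * k ^+ 2 / e ^+ 2 / mu m ^+ 2); last first.
    have mu_neq0 : mu m != 0 by rewrite gt_eqF//; lra.
    by rewrite /t; field; rewrite mu_neq0 !gt_eqF.
  have c1 : 0 <= 16 * k ^+ 2 / e ^+ 2.
    by apply: divr_ge0; [apply: mulr_ge0 => //|]; exact: sqr_ge0.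
  apply: (ler_wpM2l c1); rewrite lef_pV2 ?posrE ?exprn_gt0//.
  by rewrite expr2 ler_peMr// ltW.
by move: muD; rewrite (ler_pdivrMr _ _ e'0) (ler_pdivrMr _ _ mu0) mulrC.
Unshelve. all: by end_near. Qed.

Variables (sh_eta sh_eps : forall m, T m -> R) (q : R).
Arguments sh_eta : clear implicits.
Arguments sh_eps : clear implicits.
Hypothesis m_sh : forall m, measurable_fun setT (sh_eta m) /\ measurable_fun setT (sh_eps m).
Hypothesis sh_eta_cvg : cvg_in_prob P (fun m w => sh_eta m w / sig_eta m) 1.
Hypothesis sh_eps_cvg : cvg_in_prob P (fun m w => sh_eps m w / sig_eps m) 1.
Hypothesis q0 : 0 < q.

(** Outside four events of vanishing probability, covering [beta] means [|W + rem| <= |q * V|],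
    where [V] is the product of the two ratios of estimated to true deviations. [rem] and [V - 1]
    each shift the threshold by at most [b / 2]. *)
Lemma coverage_cvg : (fun m => fine (P m [set w |
      `|beta - betahat K beta pi eta eps w|
        <= `|q * (SS K pi eta w / Num.sqrt (K m)%:R)^-1 * sh_eta m w * sh_eps m w|]))
    @ \oo --> 2 * Phi q - 1.
Proof.
apply: (sandwich_cvg mW _ W_trap_cvg q0) => [m|b b0].
  rewrite -[X in measurable X]setTI; apply: measurable_fun_le => //.
    apply: measurableT_comp => //; apply: measurable_funB => //; exact: mbetahat.
  apply: measurableT_comp => //; case: (m_sh m) => m1 m2.
  apply: measurable_funM => //; apply: measurable_funM => //; apply: measurable_funM => //.
  apply: (measurableT_comp measurable_fun_invr); apply: measurable_funM => //.
(* Two ratios within [tau <= 1] of 1 have a product within [tau ^+ 2 + 2 * tau <= 3 * tau] of 1; the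
   other bound gives [3 * q * tau <= b / 2]. *)
pose tau := Num.min 1 (b / (6 * q)).
have tau0 : 0 < tau by rewrite lt_min ltr01 divr_gt0// mulr_gt0.
have tau1 : tau <= 1 by rewrite ge_min lexx.
have tauq : 3 * q * tau <= b / 2.
  have : tau <= b / (6 * q) by rewrite ge_min lexx orbT.
  by rewrite ler_pdivlMr ?mulr_gt0//; lra.
pose B1 m := [set w | mu m / 2 <= `|noise m w|].
pose B2 m := [set w | b / 2 <= `|rem m w|].
pose B3 m := [set w | tau < `|sh_eta m w / sig_eta m - 1|].
pose B4 m := [set w | tau < `|sh_eps m w / sig_eps m - 1|].
have mB1 m : measurable (B1 m) by exact: measurable_norm_ge.
have mB2 m : measurable (B2 m) by exact: measurable_norm_ge.
have m34 (m : nat) (Y : T m -> R) (s : R) : measurable_fun setT Y ->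
    measurable [set w | tau < `|Y w / s - 1|].
  move=> mY; rewrite -[X in measurable X]setTI.
  apply: (measurable_fun_ltr (D := setT) _ _ measurableT (Y := [set true])) => //.
  apply: measurableT_comp => //; apply: measurable_funB => //.
  exact: measurable_funM.
have mB3 m : measurable (B3 m) by apply: m34; case: (m_sh m).
have mB4 m : measurable (B4 m) by apply: m34; case: (m_sh m).
have mB12 m := measurableU _ _ (mB1 m) (mB2 m).
have mB34 m := measurableU _ _ (mB3 m) (mB4 m).
exists (fun m => (B1 m `|` B2 m) `|` (B3 m `|` B4 m)); split.
- by move=> m; exact: measurableU.
- have b20 : 0 < b / 2 by rewrite divr_gt0.
  have lim : (fun m => (fine (P m (B1 m)) + fine (P m (B2 m))) +
      (fine (P m (B3 m)) + fine (P m (B4 m)))) @ \oo --> (0 + 0 + (0 + 0) : R).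
    apply: cvgD; apply: cvgD; [exact: noise_cvg|exact: rem_cvg|exact: sh_eta_cvg|].
    exact: sh_eps_cvg.
  rewrite !addr0 in lim.
  apply: (squeeze_cvgr _ (cvg_cst 0) lim); near=> m; rewrite fine_ge0//=.
  apply: (le_trans (fine_probabilityU (P m) (mB12 m) (mB34 m))).
  by apply: lerD; exact: fine_probabilityU.
near=> m.
have K0 : (0 < K m)%N by near: m.
have mu1 : 1 <= mu m by near: m; exact: near_mu.
suff H w : ~ ((B1 m `|` B2 m) `|` (B3 m `|` B4 m)) w ->
    [/\ `|rem m w| < b / 2, (`|beta - betahat K beta pi eta eps w| <=
      `|q * (SS K pi eta w / Num.sqrt (K m)%:R)^-1 * sh_eta m w * sh_eps m w|) =
      (`|W m w + rem m w| <= `|q * (sh_eta m w / sig_eta m * (sh_eps m w / sig_eps m))|),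
      q - b / 2 <= `|q * (sh_eta m w / sig_eta m * (sh_eps m w / sig_eps m))| &
      `|q * (sh_eta m w / sig_eta m * (sh_eps m w / sig_eps m))| <= q + b / 2].
  split=> w /= Hw; apply: contrapT => /not_orP[nw /H[rw E l u]].
    apply: nw; move: Hw; rewrite E => Zw.
    rewrite -(addrK (rem m w) (W m w)) (le_trans (ler_normB _ _))//; lra.
  by apply: nw; rewrite E (le_trans (ler_normD _ _))//; lra.
move=> /not_orP[/not_orP[/negP + /negP +] /not_orP[/negP + /negP]].
rewrite -!ltNge -!leNgt => N rw Ve Vp.
have tt0 : 0 < mu m + noise m w by move: N; rewrite ltr_norml => /andP[]; lra.
have V3 : `|sh_eta m w / sig_eta m * (sh_eps m w / sig_eps m) - 1| <= 3 * tau.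
  move: Ve Vp; move: (sh_eta m w / _) (sh_eps m w / _) => x y.
  rewrite (_ : x * y - 1 = (x - 1) * (y - 1) + (x - 1) + (y - 1)); last by ring.
  move: (x - 1) (y - 1) => {}x {}y hx hy.
  rewrite (le_trans (ler_normD _ _))// (_ : 3 * tau = tau + tau + tau); last by ring.
  rewrite lerD// (le_trans (ler_normD _ _))// lerD// normrM.
  by rewrite -[leRHS]mulr1 ler_pM// (le_trans hy).
split=> //.
- rewrite betahatE; exact: (coverage_studentized beta q _ _ (rn0 K0) (s_eta0 m) (s_eps0 m)
    tt0 (SS_decomposition w K0) (numerator_decomposition w K0)).
- move: V3; move: (sh_eta m w / _ * _) => V; rewrite ler_norml => /andP[V1 V2].
  apply: le_trans (ler_norm _).
  have : q * (1 - 3 * tau) <= q * V by rewrite ler_pM2l//; lra.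
  by lra.
- move: V3; move: (sh_eta m w / _ * _) => V V3.
  rewrite normrM gtr0_norm//.
  have : `|V| <= 1 + 3 * tau.
    by rewrite -(subrK 1 V) (le_trans (ler_normD _ _))// normr1 addrC lerD2l.
  by move=> /(ler_wpM2l (ltW q0)); lra.
Unshelve. all: by end_near. Qed.

End jackknife.

Theorem theorem3 (R : realType) (d : measure_display)
  (T : nat -> measurableType d) (P : forall m, probability (T m) R)
  (K : nat -> nat) (beta : R) (pi : nat -> nat -> R)
  (eta eps : forall m, nat -> bool -> T m -> R)
  (sig_eta sig_eps : nat -> R) (c : R)
  (sh_eta sh_eps : forall m, T m -> R) (alpha q : R) :
  (* K_m -> infinity *)
  (fun m => (K m)%:R : R) @ \oo --> +oo ->
  (* measurability of the errors *)
  (forall m a v, measurable_fun setT (eta m a v) /\ measurable_fun setT (eps m a v)) ->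
  (* the pairs (eta_{a,v,m}, eps_{a,v,m}), a < K_m, v in {0,1}, are i.i.d. *)
  (forall m, mutually_independent (P m)
     (fun i : 'I_(K m) * bool => fun w => (eta m i.1 i.2 w, eps m i.1 i.2 w))) ->
  (forall m, identically_distributed (P m)
     (fun i : 'I_(K m) * bool => fun w => (eta m i.1 i.2 w, eps m i.1 i.2 w))) ->
  (* mean zero *)
  (forall m a v, (a < K m)%N ->
     ('E_(P m)[eta m a v] = 0)%E /\ ('E_(P m)[eps m a v] = 0)%E) ->
  (* variances *)
  (forall m, 0 < sig_eta m /\ 0 < sig_eps m) ->
  (forall m a v, (a < K m)%N ->
     ('E_(P m)[fun w => (eta m a v w ^+ 2)%R] = (sig_eta m ^+ 2)%R%:E)%E /\
     ('E_(P m)[fun w => (eps m a v w ^+ 2)%R] = (sig_eps m ^+ 2)%R%:E)%E) ->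
  (* assumption (a) *)
  (fun m => (\sum_(a < K m) pi m a ^+ 2) / ((K m)%:R * sig_eta m ^+ 2)) @ \oo --> (0 : R) ->
  0 <= c ->
  (fun m => sig_eps m / sig_eta m) @ \oo --> c ->
  (fun m => (\sum_(a < K m) pi m a ^+ 2) / (Num.sqrt (K m)%:R * sig_eta m ^+ 2))
     @ \oo --> +oo ->
  (* assumption (b): Lindeberg *)
  (forall e : R, 0 < e ->
     (fun m => ('E_(P m)[fun w => (
        let z := eta m 0%N false w * eps m 0%N true w / (sig_eta m * sig_eps m) in
        if e * Num.sqrt (K m)%:R <= `|z| then z ^+ 2 else 0)%R])%E) @ \oo --> 0%E) ->
  (* consistent variance estimators *)
  (forall m, measurable_fun setT (sh_eta m) /\ measurable_fun setT (sh_eps m)) ->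
  cvg_in_prob P (fun m w => sh_eta m w / sig_eta m) 1 ->
  cvg_in_prob P (fun m w => sh_eps m w / sig_eps m) 1 ->
  (* level and normal quantile *)
  0 < alpha < 1 ->
  normal_prob 0 1 [set x | x <= q] = (1 - alpha / 2)%:E ->
  (fun m => fine (P m [set w |
      `|beta - betahat K beta pi eta eps w|
        <= `|q * (SS K pi eta w / Num.sqrt (K m)%:R)^-1 * sh_eta m w * sh_eps m w|]))
    @ \oo --> 1 - alpha
  /\ cvg_in_prob P (betahat K beta pi eta eps) beta.
Proof.
move=> hK hm hI hD hE hs hV hr hc hk hmu hL hmsh h1 h2 /andP[a0 a1] hq.
have Phiq : Phi q = 1 - alpha / 2.
  have -> : Phi q = fine (normal_prob 0 1 [set x | x <= q]) by [].
  by rewrite hq.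
(* Positivity of the quantile comes from [alpha < 1], which gives [1 - alpha / 2 > 1 / 2]. *)
have q0 : 0 < q by apply: Phi_gt_half; rewrite Phiq; lra.
split; last exact: (betahat_consistent beta hK hm hI hE hs hV hr hc hk hmu).
have -> : 1 - alpha = 2 * Phi q - 1 by rewrite Phiq; field.
exact: (coverage_cvg beta hK hm hI hD hE hs hV hr hmu hL hmsh h1 h2 q0).
Qed.
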